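(* Let $\Delta>2$ be an integer and let $T$ be an $n$-vertex tree with maximum degree at least $\Delta$ that has a perfect matching. Then $$F(T)\ge 2(n-2\Delta+3)\cdot 3^{\Delta-2}+3\Delta-5+\binom{n-2\Delta+3}{2},$$ $$F^*(T)\ge 2(n-2\Delta+3)\cdot 3^{\Delta-2}-(n-2\Delta+2)\cdot 2^{\Delta-2}+n-1.$$ Equality holds in the first inequality if and only if $T\cong T'_{n,\Delta}$, and equality holds in the second inequality if and only if $T\cong T'_{n,\Delta}$.
   Context: All graphs are finite and simple. A leaf of a tree is a vertex of degree $1$. A subtree of a tree $T$ is a (nonempty) connected induced subgraph of $T$. $F(T)$ denotes the number of subtrees of $T$, and $F^*(T)$ denotes the number of subtrees of $T$ that contain at least one leaf of $T$ (leaf containing subtrees). $P_m$ is the path on $m$ vertices. $T'_{n,\Delta}$ is the $n$-vertex tree obtained from the path $P_{n-2\Delta+3}$ by attaching $\Delta-2$ copies of $P_3$ and one $P_2$ to one endvertex $u$ of $P_{n-2\Delta+3}$, where attaching a path to $u$ means identifying an endvertex of that path with $u$ (so $\Delta-2$ pendant paths of length $2$ and one pendant edge are added at $u$). *)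

(* Defs.v *)
From mathcomp Require Import all_boot.

Set Implicit Arguments.
Unset Strict Implicit.
Unset Printing Implicit Defensive.

Record sgraph := SGraph {
  vertex :> finType;
  adj : rel vertex;
  adj_sym : symmetric adj;
  adj_irr : irreflexive adj }.

Definition degree (G : sgraph) (x : G) : nat := #|[set y | adj x y]|.

Definition max_degree (G : sgraph) : nat := \max_(x : G) degree x.

Definition leaf (G : sgraph) (x : G) : bool := degree x == 1.

(* The subgraph of G induced by S is nonempty and connected: connectivity uses
   only the edges of G with both ends in S. *)
Definition connected_set (G : sgraph) (S : {set G}) : bool :=
  (S != set0) &&
  [forall x in S, forall y in S,
     connect [rel u v | [&& u \in S, v \in S & adj u v]] x y].

(* The sequences of size less than 3 are excluded from the cycles: an edge
   walked back and forth satisfies ucycle. *)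
Definition acyclic (G : sgraph) : Prop :=
  forall c : seq G, ucycle (@adj G) c -> size c < 3.

Definition is_tree (G : sgraph) : Prop :=
  connected_set [set: G] /\ acyclic G.

Definition edges (G : sgraph) : {set {set G}} :=
  [set [set p.1; p.2] | p : G * G & adj p.1 p.2].

Definition perfect_matching (G : sgraph) (M : {set {set G}}) : bool :=
  (M \subset edges G) && partition M [set: G].

Definition isomorphic (G H : sgraph) : Prop :=
  exists2 f : G -> H, bijective f & {mono f : x y / adj x y}.

(* An induced subgraph is identified with its set of vertices. *)
Definition num_subtrees (G : sgraph) : nat :=
  #|[set S : {set G} | connected_set S]|.

Definition num_leaf_subtrees (G : sgraph) : nat :=
  #|[set S : {set G} | connected_set S && [exists x in S, leaf x]]|.

Section Tprime.
Variables n D : nat.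

(* inl i is the i-th vertex of the path P_{n-2D+3}, whose endvertex u is inl 0;
   inr (inl (k, 0)) and inr (inl (k, 1)) are the two vertices other than u of
   the k-th attached P_3, the first one being the neighbour of u;
   inr (inr tt) is the vertex other than u of the attached P_2. *)
Definition Tprime_vertex : finType :=
  ('I_(n - 2 * D + 3) + ('I_(D - 2) * 'I_2 + unit))%type.

(* Each edge in the direction away from u. *)
Definition Tprime_arc (x y : Tprime_vertex) : bool :=
  match x, y with
  | inl i, inl j => j == i.+1 :> nat
  | inl i, inr (inl (_, a)) => (i == 0 :> nat) && (a == 0 :> nat)
  | inr (inl (k, a)), inr (inl (l, b)) => (k == l) && (b == a.+1 :> nat)
  | inl i, inr (inr _) => i == 0 :> nat
  | _, _ => false
  end.

Definition Tprime_adj : rel Tprime_vertex :=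
  [rel x y | Tprime_arc x y || Tprime_arc y x].

Lemma Tprime_adj_sym : symmetric Tprime_adj.
Proof. by move=> x y; apply: orbC. Qed.

Lemma Tprime_adj_irr : irreflexive Tprime_adj.
Proof.
case=> [i|[[k a]|[]]] //.
  by apply/norP; split; rewrite /= ltn_eqF.
by apply/norP; split; rewrite /= eqxx ltn_eqF.
Qed.

Definition Tprime : sgraph := SGraph Tprime_adj_sym Tprime_adj_irr.

End Tprime.

(* Main.v *)
Require Import Defs.
From mathcomp Require Import all_boot zify.

(** Root the tree T at a vertex u of degree at least D and let m_1, ..., m_d be
    the numbers of vertices of the branches at u, so that their sum is n - 1.

    A family of subtrees of T can be written down from the paths of T alone.
    Choosing in every branch one vertex or none, the union of the paths from u
    to the chosen vertices is a subtree ([span]); there are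
    (1 + m_1) ... (1 + m_d) of these. The path between two comparable vertices
    of one branch is a subtree that avoids u ([interval]). Two incomparable
    vertices of one branch give the union of their paths to u, and this union
    with u removed ([fork_of]): two more subtrees, that is, one more than a
    pair of vertices of one branch is entitled to in the sum of the binomials
    C(m_i + 1, 2). Hence F(T) >= prod (1 + m_i) + sum C(m_i + 1, 2), the
    [spider_weight] of the m_i. If every branch is a path hanging from its end
    (T is a spider with centre u) there are no other subtrees and equality
    holds; otherwise there are incomparable pairs and the inequality is strict.

    For leaf-containing subtrees fix one leaf below every vertex. The unions
    of paths through at least one of the leaves fixed for the branches number
    prod (1 + m_i) - prod m_i, and the paths going from a vertex other than u
    down to its leaf number sum m_i. Their total is the [spider_leaf_weight] of
    the m_i, again with equality exactly for spiders, because the fork of two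
    incomparable vertices, one of them a leaf, is always missed.

    It remains to minimise the two weights over sequences with sum n - 1, at
    least D positive terms, and at most one term equal to 1: two branches that
    are single vertices would be two leaves that the perfect matching both
    matches with u. Once the other terms are fixed, either weight depends on
    two terms x and y only through x + y and, increasingly, through x y. So
    both weights decrease when two terms are made more unequal, and when two
    terms are merged into one. This drives every sequence to 1, 2, ..., 2, y
    with D terms ([extremal_lengths_min]), the leg lengths of T'. Finally a
    spider is determined up to isomorphism by its leg lengths
    ([extremal_spider_isomorphic]), and the same count evaluates F and F* on
    T' itself. *)

Set Implicit Arguments.
Unset Strict Implicit.
Unset Printing Implicit Defensive.

(** * Minimal sequences of leg lengths *)

(** The number of subtrees of a spider with legs of lengths s: the subtrees
    through the centre, then those inside a leg. *)
Definition spider_weight (s : seq nat) : nat :=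
  \prod_(x <- s) x.+1 + \sum_(x <- s) 'C(x.+1, 2).

(** The number of leaf-containing subtrees of such a spider: of the choices of
    an initial segment in every leg, those that reach the end of no leg are
    discarded; inside a leg, a subpath is determined by its top vertex. *)
Definition spider_leaf_weight (s : seq nat) : nat :=
  \prod_(x <- s) x.+1 - \prod_(x <- s) x + \sum_(x <- s) x.

Lemma double_bin2S x : 'C(x.+1, 2) * 2 = x.+1 * x.
Proof. by elim: x => // x IH; rewrite binS bin1 mulnDl IH; nia. Qed.

Lemma prod_gt0 (r : seq nat) : all (leq 1) r -> 0 < \prod_(x <- r) x.
Proof.
by elim: r => [|x r IH] /=; rewrite ?big_nil ?big_cons // => /andP[? /IH]; nia.
Qed.

Lemma leq_prod_prodS (r : seq nat) : \prod_(x <- r) x <= \prod_(x <- r) x.+1.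
Proof. by elim: r => [|x r IH]; rewrite ?big_nil ?big_cons //; nia. Qed.

Lemma ltn_prod_prodS (r : seq nat) :
  r != [::] -> \prod_(x <- r) x < \prod_(x <- r) x.+1.
Proof.
case: r => // x r _; rewrite !big_cons.
have := leq_prod_prodS r; have : 0 < \prod_(x <- r) x.+1 by apply: prodn_gt0.
by nia.
Qed.

Definition shift_decreasing (J : seq nat -> nat) : Prop :=
  forall x y x' y' r, r != [::] -> all (leq 1) r ->
    x + y = x' + y' -> x' * y' < x * y -> J (x' :: y' :: r) < J (x :: y :: r).

Definition merge_decreasing (J : seq nat -> nat) : Prop :=
  forall x y r, 0 < x -> 0 < y -> r != [::] -> all (leq 1) r ->
    J (x + y :: r) < J (x :: y :: r).

Definition perm_invariant (J : seq nat -> nat) : Prop :=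
  forall s t, perm_eq s t -> J s = J t.

Lemma spider_weight_perm : perm_invariant spider_weight.
Proof. by move=> s t st; rewrite /spider_weight !(perm_big _ st). Qed.

Lemma spider_leaf_weight_perm : perm_invariant spider_leaf_weight.
Proof. by move=> s t st; rewrite /spider_leaf_weight !(perm_big _ st). Qed.

(** With P the product of the other successors, the part of the weight that
    depends on x y for a fixed sum x + y is P x y - x y, and P >= 2 since
    another term is present. *)
Lemma spider_weight_shift : shift_decreasing spider_weight.
Proof.
move=> x y x' y' r r0 rpos eS ltP; rewrite /spider_weight !big_cons.
have := ltn_prod_prodS r0; have := prod_gt0 rpos.
have := double_bin2S x; have := double_bin2S y.
have := double_bin2S x'; have := double_bin2S y'.
move: (\prod_(_ <- _) _.+1) (\prod_(_ <- _) _) (\sum_(_ <- _) _) => P Q S.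
move: 'C(_, _) 'C(_, _) 'C(_, _) 'C(_, _) => a b c d Ha Hb Hc Hd Q0 QP.
have [k ek] : exists k, x * y = x' * y' + k.+1 by exists (x * y - x' * y').-1; lia.
have [l el] : exists l, P = l.+2 by exists P.-2; lia.
subst P; have : (x + y) * (x + y) = (x' + y') * (x' + y') by rewrite eS.
nia.
Qed.

(** Here x y has the coefficient P - Q, where P and Q are the products of the
    other successors and of the other terms; Q < P as r is not empty. *)
Lemma spider_leaf_weight_shift : shift_decreasing spider_leaf_weight.
Proof.
move=> x y x' y' r r0 rpos eS ltP; rewrite /spider_leaf_weight !big_cons.
have := ltn_prod_prodS r0; have := prod_gt0 rpos.
move: (\prod_(_ <- _) _.+1) (\prod_(_ <- _) _) => P Q.
move: (\sum_(_ <- _) _) => S Q0 QP.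
have [k ek] : exists k, x * y = x' * y' + k.+1 by exists (x * y - x' * y').-1; lia.
have [l el] : exists l, P = Q + l.+1 by exists (P - Q).-1; lia.
subst P; nia.
Qed.

(** C(x + y + 1, 2) = C(x + 1, 2) + C(y + 1, 2) + x y, whereas the product
    loses P x y with P >= 2. *)
Lemma spider_weight_merge : merge_decreasing spider_weight.
Proof.
move=> x y r x0 y0 r0 rpos; rewrite /spider_weight !big_cons.
have := ltn_prod_prodS r0; have := prod_gt0 rpos.
have := double_bin2S x; have := double_bin2S y; have := double_bin2S (x + y).
move: (\prod_(_ <- _) _.+1) (\prod_(_ <- _) _) (\sum_(_ <- _) _) => P Q S.
move: 'C(_, _) 'C(_, _) 'C(_, _) => a b c Ha Hb Hc Q0 QP.
have [l el] : exists l, P = l.+2 by exists P.-2; lia.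
by subst P; nia.
Qed.

Lemma spider_leaf_weight_merge : merge_decreasing spider_leaf_weight.
Proof.
move=> x y r x0 y0 r0 rpos; rewrite /spider_leaf_weight !big_cons.
have := ltn_prod_prodS r0; have := prod_gt0 rpos.
move: (\prod_(_ <- _) _.+1) (\prod_(_ <- _) _) => P Q.
move: (\sum_(_ <- _) _) => S Q0 QP.
have [l el] : exists l, P = Q + l.+1 by exists (P - Q).-1; lia.
subst P; nia.
Qed.

(** The leg lengths of T' when m is its number of vertices other than the
    centre. *)
Definition extremal_lengths (D m : nat) : seq nat :=
  1 :: m - 1 - 2 * (D - 2) :: nseq (D - 2) 2.

Lemma all2_nseq (s : seq nat) : all (pred1 2) s -> s = nseq (size s) 2.
Proof. exact: (elimT (all_pred1P 2 s)). Qed.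

Lemma sumn_perm (s t : seq nat) : perm_eq s t -> sumn s = sumn t.
Proof. by move=> st; rewrite !sumnE (perm_big _ st). Qed.

(** If all terms except one 1 and possibly one other are equal to 2, the sum
    determines the sequence. *)
Lemma two_large_or_extremal D s :
    2 < D -> size s = D -> all (leq 1) s -> count_mem 1 s = 1 ->
  (exists z w r, perm_eq s (z :: w :: 1 :: r) /\ (2 < z /\ 2 < w))
  \/ perm_eq s (extremal_lengths D (sumn s)).
Proof.
move=> D2 sD s1 c1.
have s_1 : 1 \in s by rewrite -has_pred1 has_count c1.
have ps := perm_to_rem s_1; set t := rem 1 s in ps.
have st : size t = D.-1 by have := perm_size ps; rewrite /=; lia.
have t2 : all (leq 2) t.
  apply/allP => x xt; have : 0 < x by apply: (allP s1); rewrite (perm_mem ps) inE xt orbT.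
  case: x xt => [|[|x]] // xt _.
  move/permP: ps => /(_ (pred1 1)) /=; rewrite c1 => /eqP.
  by rewrite -[1 in X in X -> _]addn0 eqn_add2l eq_sym -leqn0 leqNgt -has_count has_pred1 xt.
have [z [t' [pt ht]]] : exists z t', perm_eq t (z :: t') /\
    ((z == 2) && all (pred1 2) t' || (2 < z)).
  case: (boolP (all (pred1 2) t)) => [a2|/allPn[z zt z2]].
    by case: (t) st a2 => [|z t'] /=; first lia; exists z, t'; rewrite a2.
  exists z, (rem z t); split; first exact: perm_to_rem.
  by have := allP t2 _ zt; move: z2; rewrite /= orbC; lia.
have ps2 : perm_eq s (1 :: z :: t').
  by apply: (perm_trans ps); rewrite perm_cons.
have t'2 : all (leq 2) t'.
  by move: t2; rewrite (perm_all _ pt) /= => /andP[].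
case: (boolP (all (pred1 2) t')) => [/all2_nseq a2|/allPn[w wt w2]].
  right; have st' : size t' = D - 2 by have := perm_size ps2; rewrite /=; lia.
  rewrite st' in a2; rewrite /extremal_lengths (sumn_perm ps2) /= a2 sumn_nseq -a2.
  by rewrite (_ : _ - _ - _ = z); last lia.
left; exists z, w, (rem w t'); split.
  apply: (perm_trans ps2); rewrite -(cat1s 1) perm_catC /=.
  rewrite perm_cons; apply: (@perm_trans _ (1 :: t')).
    by rewrite -(cat1s 1 t') perm_catC.
  apply: (@perm_trans _ (1 :: w :: rem w t')).
    by rewrite perm_cons perm_to_rem.
  by rewrite (perm_catCA [:: 1] [:: w] (rem w t')).
move: ht (allP t'2 _ wt) w2; case/orP => [/andP[_ /allP /(_ _ wt) /= ->] //|z2] /=.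
by lia.
Qed.

(** Strong induction on J s: unless s is already extremal, one shift or one
    merge yields an admissible sequence of the same sum and smaller J. *)
Theorem extremal_lengths_min (J : seq nat -> nat) D s :
    perm_invariant J -> shift_decreasing J -> merge_decreasing J ->
    2 < D -> D <= size s -> all (leq 1) s -> count_mem 1 s <= 1 ->
  J (extremal_lengths D (sumn s)) < J s \/ perm_eq s (extremal_lengths D (sumn s)).
Proof.
move=> Jp Js Jm D2.
have [N] := ubnP (J s); elim: N s => // N IH s /ltnSE leN sD s1 c1.
have descend s' : J s' < J s -> D <= size s' -> all (leq 1) s' ->
    count_mem 1 s' <= 1 -> sumn s' = sumn s ->
    J (extremal_lengths D (sumn s)) < J s.
  move=> lt sD' s1' c1' es.
  have [|h] := IH s' (leq_trans lt leN) sD' s1' c1'; first by rewrite es; lia.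
  by rewrite -es -(Jp _ _ h).
have r0 r : 0 < size r -> r != [::] :> seq nat by case: r.
have [sizeD|sizeD] := eqVneq (size s) D; last first.
  (* There are more than D terms: merging two of them leaves at least D. *)
  case: s leN sD s1 c1 descend sizeD => [|x [|y r]] //= leN; try lia.
  move=> sD /and3P[x0 y0 r1] c1 descend sizeD; left.
  apply: (descend (x + y :: r)) => /=; try lia.
  by apply: Jm => //; apply: r0; lia.
have [c|c] := eqVneq (count_mem 1 s) 1.
  (* Shrinking a term larger than 2 to 2 does not create a second 1. *)
  have [[z [w [r [ps [z2 w2]]]]]|] := two_large_or_extremal D2 sizeD s1 c; last by right.
  left; have := perm_all (leq 1) ps; rewrite s1 /= => /esym/andP[_ /andP[_ r1]].
  have := permP ps (pred1 1); have := perm_size ps; rewrite /= => esz ec.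
  apply: (descend (2 :: z + w - 2 :: 1 :: r)); rewrite /= ?r1 //; try by lia.
  - by rewrite (Jp _ _ ps); apply: Js => //; nia.
  - have -> : (z + w - 2 == 1) = false by lia.
    by have ez : (z == 1) = false by [lia]; rewrite c ez in ec; lia.
  by rewrite (sumn_perm ps) /=; lia.
(* No term equals 1: any term may be shrunk to 1. *)
left; case: s leN sD s1 c1 c descend sizeD => [|x [|y r]] //= leN; try lia.
move=> sD /and3P[x0 y0 r1] c1 c descend sizeD.
apply: (descend (1 :: x + y - 1 :: r)) => /=; try lia.
- by apply: Js => //; [apply: r0 | | nia]; lia.
Qed.

(** This is what forces 2 D <= n. *)
Lemma sumn_lower_bound s : all (leq 1) s -> 2 * size s <= sumn s + count_mem 1 s.
Proof. by elim: s => //= x s IH /andP[? /IH]; lia. Qed.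

Lemma prod_nseq (F : nat -> nat) k a : \prod_(x <- nseq k a) F x = F a ^ k.
Proof. by elim: k => [|k IH]; rewrite ?big_nil ?big_cons ?IH ?expnS. Qed.

Lemma sum_nseq (F : nat -> nat) k a : \sum_(x <- nseq k a) F x = k * F a.
Proof. by elim: k => [|k IH]; rewrite ?big_nil ?big_cons ?IH. Qed.

Lemma spider_weight_extremal n D : 2 < D -> 2 * D <= n ->
  spider_weight (extremal_lengths D n.-1)
  = 2 * (n - 2 * D + 3) * 3 ^ (D - 2) + 3 * D - 5 + 'C(n - 2 * D + 3, 2).
Proof.
move=> D2 Dn; rewrite /spider_weight /extremal_lengths !big_cons.
rewrite prod_nseq sum_nseq.
rewrite (_ : (n.-1 - 1 - 2 * (D - 2)).+1 = n - 2 * D + 3); last lia.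
rewrite !binn (_ : 'C(3, 2) = 3) // mulnA; move: (2 * _ * _) 'C(_, _) => A B; lia.
Qed.

Lemma spider_leaf_weight_extremal n D : 2 < D -> 2 * D <= n ->
  spider_leaf_weight (extremal_lengths D n.-1)
  = 2 * (n - 2 * D + 3) * 3 ^ (D - 2) - (n - 2 * D + 2) * 2 ^ (D - 2) + n - 1.
Proof.
move=> D2 Dn; rewrite /spider_leaf_weight /extremal_lengths !big_cons.
rewrite !prod_nseq (sum_nseq id).
rewrite (_ : (n.-1 - 1 - 2 * (D - 2)).+1 = n - 2 * D + 3); last lia.
rewrite (_ : (n.-1 - 1 - 2 * (D - 2)) = n - 2 * D + 2); last lia.
by lia.
Qed.

(** * Rooted trees *)

(** Edges are exactly the pairs formed by a vertex and its parent, which makes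
    the graph a tree; all counting below is done from parents and depths. The
    parent of the origin is the origin itself, so that iterating parents is
    always meaningful. *)
Record rooting (G : sgraph) := Rooting {
  origin : G;
  parent : G -> G;
  depth : G -> nat;
  parent_origin : parent origin = origin;
  depth_origin : depth origin = 0;
  depth_parent : forall x, x != origin -> depth x = (depth (parent x)).+1;
  adj_parent : forall x y : G,
    adj x y = (x != origin) && (parent x == y) || (y != origin) && (parent y == x) }.

Section Rooted.
Variables (G : sgraph) (R : rooting G).
Implicit Types x y z v : G.

Local Notation u := (origin R).
Local Notation p := (parent R).
Local Notation dep := (depth R).

(** Ancestors, a vertex being an ancestor of itself. *)
Definition anc x y : bool := fconnect p y x.

Lemma ancP x y : reflect (exists k, x = iter k p y) (anc x y).
Proof.
apply: (iffP idP) => [h|[k ->]]; last exact: fconnect_iter.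
by exists (findex p y x); rewrite iter_findex.
Qed.

Lemma anc_refl x : anc x x. Proof. exact: connect0. Qed.

Lemma anc_trans y x z : anc x y -> anc y z -> anc x z.
Proof. by move=> xy yz; apply: connect_trans yz xy. Qed.

Lemma anc_parent x : anc (p x) x. Proof. exact: fconnect1. Qed.

Lemma iter_parent_origin k : iter k p u = u.
Proof. by elim: k => //= k ->; apply: parent_origin. Qed.

Lemma depth_parentE x : dep (p x) = (dep x).-1.
Proof.
have [->|/(depth_parent (r := R)) -> //] := eqVneq x u.
by rewrite parent_origin depth_origin.
Qed.

Lemma depth_iter k x : dep (iter k p x) = dep x - k.
Proof. by elim: k => [|k IH] /=; rewrite ?subn0 // depth_parentE IH subnS. Qed.

Lemma depth_eq0 x : (dep x == 0) = (x == u).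
Proof.
have [->|xu] := eqVneq x u; first by rewrite depth_origin.
by rewrite (depth_parent xu).
Qed.

Lemma depth_gt0 x : (0 < dep x) = (x != u).
Proof. by rewrite lt0n depth_eq0. Qed.

Lemma iter_depth x : iter (dep x) p x = u.
Proof. by apply/eqP; rewrite -depth_eq0 depth_iter subnn. Qed.

Lemma anc_root x : anc u x.
Proof. by rewrite -(iter_depth x); apply: fconnect_iter. Qed.

Lemma anc_depth x y : anc x y -> dep x <= dep y.
Proof. by case/ancP=> k ->; rewrite depth_iter leq_subr. Qed.

Lemma anc_iter x y : anc x y -> x = iter (dep y - dep x) p y.
Proof.
case/ancP=> k ->; rewrite depth_iter.
have [le_k|lt_k] := leqP k (dep y); first by rewrite subKn.
rewrite (_ : dep y - k = 0); last by lia.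
by rewrite subn0 -(subnKC (ltnW lt_k)) addnC iterD iter_depth iter_parent_origin.
Qed.

Lemma anc_same_depth x y : anc x y -> dep y <= dep x -> x = y.
Proof. by move=> xy le; rewrite (anc_iter xy) (_ : dep y - dep x = 0) //; lia. Qed.

Lemma anc_antisym x y : anc x y -> anc y x -> x = y.
Proof. by move=> xy /anc_depth; apply: anc_same_depth. Qed.

Lemma anc_of_parent x y : anc x y -> x != y -> anc x (p y).
Proof.
case/ancP=> [[|k]] -> /=; first by rewrite eqxx.
by rewrite -iterS iterSr => _; apply: fconnect_iter.
Qed.

Lemma anc_chain x y z : anc x z -> anc y z -> dep x <= dep y -> anc x y.
Proof.
move=> xz yz le; have le2 := anc_depth yz; rewrite (anc_iter xz) (anc_iter yz).
rewrite (_ : dep z - dep x = (dep y - dep x) + (dep z - dep y)); last by lia.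
by rewrite iterD; apply: fconnect_iter.
Qed.

Lemma anc_total x y z : anc x z -> anc y z -> anc x y || anc y x.
Proof.
move=> xz yz; have [le|/ltnW le] := leqP (dep x) (dep y).
  by rewrite (anc_chain xz yz).
by rewrite (anc_chain yz xz) ?orbT.
Qed.

Lemma anc_nonroot x y : anc x y -> x != u -> y != u.
Proof. by move=> /anc_depth; rewrite -!depth_gt0; lia. Qed.

(** For vertices other than the origin these are the leaves of the tree. *)
Definition tip v : bool := [forall z, anc v z ==> (z == v)].

Lemma tipP v : reflect (forall z, anc v z -> z = v) (tip v).
Proof.
apply: (iffP forallP) => h z; first by move/(implyP (h z))/eqP.
by apply/implyP => /h ->.
Qed.

(** Following parents from a proper descendant of v, one meets a child of v. *)
Lemma childless_tip v : (forall z, z != u -> p z != v) -> tip v.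
Proof.
move=> h; apply/tipP => z; have [//|ne] := eqVneq z v => vz.
have {ne vz} : exists2 w, w != u & p w = v.
  elim: (dep z) {-2}z (leqnn (dep z)) ne vz => [|N IH] {}z le ne vz.
    by rewrite (@anc_same_depth v z) ?eqxx // in ne; lia.
  have vp : anc v (p z) by apply: anc_of_parent; rewrite // eq_sym.
  have zu : z != u.
    by apply: contraNneq ne => zu; rewrite eq_sym (@anc_same_depth v z) // zu depth_origin.
  have [pz|pz] := eqVneq (p z) v; first by exists z.
  by apply: (IH (p z)) => //; rewrite depth_parentE; lia.
by case=> w /h /negbTE + wv; rewrite wv eqxx.
Qed.

Definition tip_below x : G := [arg max_(z > x | anc x z) dep z].

Lemma anc_tip_below x : anc x (tip_below x).
Proof. by rewrite /tip_below; case: arg_maxnP => //; apply: anc_refl. Qed.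

Lemma tip_tip_below x : tip (tip_below x).
Proof.
rewrite /tip_below; case: arg_maxnP; first exact: anc_refl.
move=> z xz zmax; apply/tipP => w zw.
by apply/esym/anc_same_depth/zmax => //; apply: anc_trans zw.
Qed.

Definition children : {set G} := [set i | (i != u) && (p i == u)].

Definition branch i : {set G} := [set x | anc i x].

(** Climbing one step less than the depth of x leads to a child of the origin;
    at the origin the value is the origin. *)
Definition branch_root x : G := iter (dep x).-1 p x.

Lemma childP i : reflect (dep i = 1) (i \in children).
Proof.
rewrite inE -depth_gt0 -depth_eq0 depth_parentE; apply: (iffP idP); lia.
Qed.

Lemma branch_root_child x : x != u -> branch_root x \in children.
Proof. by rewrite -depth_gt0 => x0; apply/childP; rewrite depth_iter; lia. Qed.

Lemma anc_branch_root x : anc (branch_root x) x.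
Proof. exact: fconnect_iter. Qed.

Lemma branch_rootE i x : i \in children -> anc i x -> branch_root x = i.
Proof. by move=> /childP di ix; rewrite [RHS](anc_iter ix) di subn1. Qed.

Lemma branch_root_anc x y : x != u -> anc x y -> branch_root x = branch_root y.
Proof.
move=> xu xy; apply/esym/branch_rootE; first exact: branch_root_child.
exact: anc_trans (anc_branch_root x) xy.
Qed.

Lemma child_nonroot i : i \in children -> i != u.
Proof. by rewrite inE => /andP[]. Qed.

Lemma branch_nonroot i x : i \in children -> anc i x -> x != u.
Proof. by move=> /child_nonroot iu ix; apply: anc_nonroot ix iu. Qed.

Lemma degree_root : degree u = #|children|.
Proof.
by apply: eq_card => y; rewrite !inE (adj_parent R) eqxx.
Qed.

Lemma tip_nonroot v : 1 < #|children| -> tip v -> v != u.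
Proof.
move=> C1; apply: contraTneq => ->; apply/negP => /tipP h.
have /card_gt0P[i iC] : 0 < #|children| by apply: ltn_trans C1.
by have := child_nonroot iC; rewrite (h i (anc_root i)) eqxx.
Qed.

(** The hypothesis keeps the origin from being a leaf. *)
Lemma leaf_tip v : 1 < #|children| -> leaf v = tip v.
Proof.
move=> C1; have [->|vu] := eqVneq v u.
  rewrite /leaf degree_root (gtn_eqF C1); apply/esym/negbTE/negP.
  by move/(tip_nonroot C1); rewrite eqxx.
have pv : adj v (p v) by rewrite (adj_parent R) vu eqxx.
rewrite /leaf /degree (cardsD1 (p v)) inE pv -[1]addn0 eqn_add2l cards_eq0.
apply/eqP/tipP => [h|h].
  apply/tipP/childless_tip => z zu; apply/eqP => pz.
  suff : z \in set0 by rewrite inE.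
  rewrite -h !inE (adj_parent R) pz zu eqxx orbT andbT.
  by apply/eqP => e; have := depth_parent vu; have := depth_parent zu; rewrite pz e; lia.
apply/setP => y; rewrite !inE (adj_parent R) vu /=; apply/negP.
case/andP=> yv /orP[/eqP e|/andP[yu /eqP e]]; first by rewrite e eqxx in yv.
have yv' : y = v by apply: h; rewrite -e anc_parent.
by have := depth_parent yu; rewrite e yv'; lia.
Qed.
End Rooted.

(** * Connected sets and spiders in a rooted tree *)

Section Connected.
Variables (G : sgraph) (R : rooting G).
Implicit Types (x y z v : G) (S : {set G}).

Local Notation u := (origin R).
Local Notation p := (parent R).
Local Notation dep := (depth R).
Local Notation anc := (anc R).
Local Notation C := (children R).
Local Notation br := (branch_root R).

(** Take for t a vertex of least depth. For another vertex x of S, the edge to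
    its parent is the only one that leaves the set of descendants of x, and t
    is not a descendant of x: a path in S from x to t uses this edge. *)
Lemma connectedP S :
  reflect (exists2 t, t \in S & forall x, x \in S -> x != t -> x != u /\ p x \in S)
          (connected_set S).
Proof.
apply: (iffP andP) => [[/set0Pn[t0 t0S] conn] | [t tS top]].
  pose t := [arg min_(x < t0 in S) dep x].
  have [tS tmin] : t \in S /\ forall x, x \in S -> dep t <= dep x.
    by rewrite /t; case: arg_minnP.
  exists t => // x xS xt.
  have xu : x != u.
    apply: contraNneq xt => xu; have := tmin x xS.
    by rewrite xu depth_origin leqn0 depth_eq0 eq_sym.
  split=> //; apply: contraT => pxS.
  have nxt : ~~ anc x t.
    by apply: contra xt => xt; rewrite (anc_same_depth xt) // tmin.
  have /(closed_connect (a := [pred z | anc x z])) :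
      connect [rel a b | [&& a \in S, b \in S & adj a b]] x t.
    by move/forallP: conn => /(_ x); rewrite xS => /forallP/(_ t); rewrite tS.
  have cl : closed [rel a b | [&& a \in S, b \in S & adj a b]] [pred z | anc x z].
    apply: intro_closed => [|a b /= /and3P[aS bS]].
      by apply: sym_connect_sym => a b; rewrite /= adj_sym andbCA.
    rewrite (adj_parent R) !inE => /orP[/andP[au /eqP e]|/andP[bu /eqP e]] xa; last first.
      rewrite -e in xa; exact: anc_trans xa (anc_parent _ _).
    rewrite -e; apply: anc_of_parent => //; apply: contraNneq pxS => ->.
    by rewrite e.
  by move/(_ cl); rewrite !inE anc_refl (negbTE nxt).
split; first by apply/set0Pn; exists t.
pose e := [rel a b | [&& a \in S, b \in S & adj a b]].
have symE : connect_sym e.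
  by apply: sym_connect_sym => a b /=; rewrite /= adj_sym andbCA.
have toT x : x \in S -> connect e x t.
  elim: (dep x) {-2}x (leqnn (dep x)) => [|N IH] {}x le xS.
    by have [->|/(top x xS)[]] := eqVneq x t; [exact: connect0 | rewrite -(depth_gt0 R); lia].
  have [->|/(top x xS)[xu px]] := eqVneq x t; first exact: connect0.
  apply: (@connect_trans _ _ (p x)); last by apply: IH => //; rewrite depth_parentE; lia.
  by apply: connect1; rewrite /= xS px (adj_parent R) xu eqxx.
apply/forall_inP => x xS; apply/forall_inP => y yS.
by apply: (connect_trans (toT x xS)); rewrite symE; apply: toT.
Qed.

Definition parent_closed S : bool := [forall x in S, p x \in S].

Lemma parent_closed_anc S x y : parent_closed S -> y \in S -> anc x y -> x \in S.
Proof.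
move=> /forall_inP cl yS /ancP[k ->]; elim: k => //= k IH; exact: cl.
Qed.

Lemma connected_origin S : u \in S -> connected_set S = parent_closed S.
Proof.
move=> uS; apply/connectedP/forall_inP => [[t tS top]|cl].
  have tu : t = u.
    by apply/eqP/contraT; rewrite eq_sym => /(top u uS); rewrite eqxx; case.
  move=> x xS; have [xu|] := eqVneq x u; first by rewrite xu parent_origin.
  by rewrite -tu => /(top x xS)[].
by exists u => // x xS xu; split; [| exact: cl].
Qed.

Lemma connected_top S : u \notin S -> connected_set S ->
  exists2 t, t \in S & forall x, x \in S -> anc t x /\
    (forall y, anc t y -> anc y x -> y \in S).
Proof.
move=> uS /connectedP[t tS top]; exists t => // x.
elim: (dep x) {-2}x (leqnn (dep x)) => [|N IH] {}x le xS.
  by move: le; rewrite leqn0 depth_eq0 => /eqP xu; rewrite xu (negbTE uS) in xS.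
have [-> | xt] := eqVneq x t.
  by split=> [|y ty yt]; [exact: anc_refl | rewrite (anc_antisym yt ty)].
have [xu pxS] := top x xS xt; have [|tp pS] := IH (p x) _ pxS.
  by rewrite depth_parentE; lia.
split=> [|y ty yx]; first exact: anc_trans tp (anc_parent R x).
by have [-> //|yx'] := eqVneq y x; apply: pS => //; apply: anc_of_parent.
Qed.

Lemma connected_of_top S t : t \in S -> t != u ->
  (forall x, x \in S -> anc t x) -> (forall x y, x \in S -> anc t y -> anc y x -> y \in S) ->
  connected_set S.
Proof.
move=> tS tu tx St; apply/connectedP; exists t => // x xS xt; split.
  by apply: anc_nonroot tu; apply: tx.
apply: (St x) => //; last exact: anc_parent.
by apply: anc_of_parent; [apply: tx | rewrite eq_sym].
Qed.

(** Equivalently, every branch is a path hanging from one of its ends; this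
    local form can be checked on the parents alone. *)
Definition is_spider : bool :=
  [forall y, forall z, (p y != u) && (p y == p z) ==> (y == z)].

Lemma is_spiderP :
  reflect (forall y z, p y != u -> p y = p z -> y = z) is_spider.
Proof.
apply: (iffP forallP) => [h y z yu yz|h y].
  by move/forallP: (h y) => /(_ z); rewrite yu yz eqxx => /eqP.
by apply/forallP => z; apply/implyP => /andP[yu /eqP/(h y z yu) ->].
Qed.

(** Away from the origin the parent map of a spider is injective, hence so are
    its iterates as long as they stay below the origin. *)
Lemma spider_iter_inj d x y : is_spider -> dep x = d.+1 -> dep y = d.+1 ->
  iter d p x = iter d p y -> x = y.
Proof.
move=> /is_spiderP sp; elim: d x y => // d IH x y dx dy.
rewrite !iterSr => e; apply: sp; first by rewrite -(depth_gt0 R) depth_parentE dx.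
by apply: IH; rewrite ?depth_parentE ?dx ?dy.
Qed.

Lemma spider_comparable x y : is_spider -> x != u -> y != u ->
  br x = br y -> dep x <= dep y -> anc x y.
Proof.
move=> sp xu yu bxy le.
suff -> : x = iter (dep y - dep x) p y by apply: fconnect_iter.
have dy : dep (iter (dep y - dep x) p y) = dep x by rewrite depth_iter subKn.
have x0 : dep x = (dep x).-1.+1 by rewrite prednK ?depth_gt0.
apply: (spider_iter_inj sp x0); first by rewrite dy.
rewrite -[LHS]/(br x) bxy -{1}dy; apply/esym/branch_root_anc/fconnect_iter.
by rewrite -(depth_gt0 R) dy depth_gt0.
Qed.

(** This set measures how far the tree is from a spider. Its pairs are ordered
    so that they can be counted together with the comparable ones. *)
Definition forked : {set G * G} :=
  [set q | [&& q.1 != u, q.2 != u, br q.1 == br q.2, ~~ anc q.1 q.2 & ~~ anc q.2 q.1]].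

Lemma spider_forked : is_spider = (forked == set0).
Proof.
apply/idP/eqP => [sp|f0].
  apply/setP => -[x y]; rewrite !inE /=; apply/negP => /and5P[xu yu /eqP b nxy nyx].
  have [le|/ltnW le] := leqP (dep x) (dep y).
    by rewrite (spider_comparable sp xu yu b le) in nxy.
  by rewrite (spider_comparable sp yu xu (esym b) le) in nyx.
apply/is_spiderP => y z pyu pyz; apply/eqP/contraT => yz.
suff : (y, z) \in forked by rewrite f0 inE.
have nu w : p w != u -> w != u by apply: contraNneq => ->; rewrite parent_origin.
have pzu : p z != u by rewrite -pyz.
have d : dep y = dep z.
  by rewrite (depth_parent (nu y pyu)) (depth_parent (nu z pzu)) pyz.
rewrite !inE /= (nu y pyu) (nu z pzu) -(branch_root_anc pyu (anc_parent R y)).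
rewrite -(branch_root_anc pzu (anc_parent R z)) pyz eqxx /=.
by apply/andP; split; apply: contra yz => /anc_same_depth ->; rewrite ?d.
Qed.
End Connected.

(** * Families of subtrees built from paths *)

Section Families.
Variables (G : sgraph) (R : rooting G).
Implicit Types (x y z v i : G) (S : {set G}) (c : {ffun G -> G}).

Local Notation u := (origin R).
Local Notation p := (parent R).
Local Notation dep := (depth R).
Local Notation anc := (anc R).
Local Notation C := (children R).
Local Notation br := (branch_root R).
Local Notation m := (fun i => #|branch R i|).
Local Notation lam := (tip_below R).

Definition branch_sizes : seq nat := [seq #|branch R i| | i <- enum C].

(** The values allowed at i for a choice function: the origin stands for
    choosing no vertex, and it is the only value at an i that is not a child
    of the origin. *)
Definition leg i : pred G :=
  if i \in C then [pred x | (x == u) || anc i x] else pred1 u.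

Definition legs : {pred {ffun G -> G}} := family leg.

Definition span (c : {ffun G -> G}) : {set G} := [set x | [exists i, anc x (c i)]].

Lemma legsP (c : {ffun G -> G}) :
  reflect (forall i, c i = u \/ i \in C /\ anc i (c i)) (c \in legs).
Proof.
apply: (iffP familyP) => h i; have := h i; rewrite /leg; case: ifP => iC; rewrite !inE.
- by case/orP=> [/eqP|]; [left | right].
- by move/eqP; left.
- by case=> [->|[_ ->]]; rewrite ?eqxx ?orbT.
by case=> [->|[]]; rewrite ?eqxx // iC.
Qed.

Lemma legs_branch_root c i : c \in legs -> c i != u -> br (c i) = i.
Proof.
by move/legsP/(_ i) => [->|[iC ic] _]; [rewrite eqxx | apply: branch_rootE].
Qed.

Lemma mem_span c i x : anc x (c i) -> x \in span c.
Proof. by move=> h; rewrite inE; apply/existsP; exists i. Qed.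

Lemma span_origin c : u \in span c.
Proof. by apply: (@mem_span c u); apply: anc_root. Qed.

Lemma span_connected c : connected_set (span c).
Proof.
rewrite (connected_origin (span_origin c)); apply/forall_inP => x.
rewrite inE => /existsP[i xi]; apply: (@mem_span c i).
exact: anc_trans (anc_parent R x) xi.
Qed.

Lemma span_comparable c x y : c \in legs -> x != u -> y != u -> br x = br y ->
  x \in span c -> y \in span c -> anc x y || anc y x.
Proof.
move=> cF xu yu bxy; rewrite !inE => /existsP[i xi] /existsP[j yj].
suff ij : i = j by apply: anc_total xi _; rewrite ij.
rewrite -(legs_branch_root cF (anc_nonroot xi xu)).
rewrite -(legs_branch_root cF (anc_nonroot yj yu)).
by rewrite -(branch_root_anc xu xi) bxy; apply: branch_root_anc.
Qed.

(** The vertex chosen in a branch is the deepest vertex of the span there. *)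
Lemma span_inj : {in legs &, injective span}.
Proof.
suff sub c c' i : c \in legs -> c' \in legs -> span c = span c' -> anc (c i) (c' i).
  move=> c c' cF cF' e; apply/ffunP => i.
  by apply: anc_antisym; apply: sub.
move=> cF cF' e; have [->|ciu] := eqVneq (c i) u; first exact: anc_root.
have : c i \in span c' by rewrite -e; apply: mem_span (anc_refl R _).
rewrite inE => /existsP[j cj].
suff ji : j = i by rewrite ji in cj.
rewrite -(legs_branch_root cF' (anc_nonroot cj ciu)) -(branch_root_anc ciu cj).
exact: legs_branch_root.
Qed.

Lemma card_legs : #|legs| = \prod_(i in C) (m i).+1.
Proof.
rewrite card_family foldrE big_map big_enum /= [RHS]big_mkcond /=.
apply: eq_bigr => i _; rewrite /leg; case: ifP => iC; last by rewrite card1.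
rewrite (cardD1 u) !inE eqxx add1n; congr _.+1; apply: eq_card => x; rewrite !inE.
have [->|//] := eqVneq x u; apply/esym/negbTE/negP.
by move=> /(branch_nonroot iC); rewrite eqxx.
Qed.

(** In a spider a subtree through the origin meets each branch in the path
    that ends at its deepest vertex there. *)
Lemma spider_span S : is_spider R -> connected_set S -> u \in S ->
  exists2 c, c \in legs & S = span c.
Proof.
move=> sp + uS; rewrite (connected_origin uS) => cl.
pose c := [ffun i => if i \in C then [arg max_(x > u | (x \in S) && leg i x) dep x] else u].
have uP i : (u \in S) && leg i u by rewrite uS /leg; case: ifP; rewrite /= ?eqxx.
have cP i : [/\ c i \in S, leg i (c i) &
    forall x, x \in S -> leg i x -> i \in C -> dep x <= dep (c i)].
  rewrite ffunE; case: ifP => iC; last by rewrite (andP (uP i)).1 (andP (uP i)).2.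
  by case: arg_maxnP => // x /andP[xS xi] xmax; split=> // y yS yi _; apply: xmax; rewrite yS.
exists c; first by apply/familyP => i; case: (cP i).
apply/setP => x; apply/idP/idP => [xS|]; last first.
  by rewrite inE => /existsP[i]; apply: parent_closed_anc => //; case: (cP i).
have [->|xu] := eqVneq x u; first exact: span_origin.
have bC := branch_root_child xu; case: (cP (br x)) => _ li /(_ x xS) le.
have {}le : dep x <= dep (c (br x)).
  by apply: le => //; rewrite /leg bC /= anc_branch_root orbT.
apply: (@mem_span c (br x)); apply: spider_comparable => //.
  by rewrite -(depth_gt0 R) (leq_trans _ le) // depth_gt0.
move: li; rewrite /leg bC /= => /orP[/eqP e|/(branch_rootE bC) //].
by rewrite e depth_origin leqn0 depth_eq0 (negbTE xu) in le.
Qed.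

Definition interval x y : {set G} := [set z | anc x z && anc z y].

Definition anc_pairs : {set G * G} := [set q | (q.1 != u) && anc q.1 q.2].

Definition interval_of (q : G * G) := interval q.1 q.2.

Lemma interval_origin x y : x != u -> u \notin interval x y.
Proof.
move=> xu; rewrite inE negb_and; apply/orP; left.
by apply/negP => /(@anc_nonroot _ R) /(_ xu); rewrite eqxx.
Qed.

Lemma interval_connected x y : x != u -> anc x y -> connected_set (interval x y).
Proof.
move=> xu xy; apply: (@connected_of_top _ R _ x) => //.
- by rewrite inE anc_refl.
- by move=> z; rewrite inE => /andP[].
by move=> z w; rewrite !inE => /andP[_ zy] -> wz; apply: anc_trans wz zy.
Qed.

Lemma interval_sub x y x' y' : anc x y ->
  interval x y = interval x' y' -> anc x' x /\ anc y y'.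
Proof.
move=> xy e; have : x \in interval x' y' by rewrite -e inE anc_refl.
have : y \in interval x' y' by rewrite -e inE xy anc_refl.
by rewrite !inE => /andP[_ ->] /andP[->].
Qed.

Lemma interval_inj : {in anc_pairs &, injective interval_of}.
Proof.
move=> [x y] [x' y']; rewrite !inE /= => /andP[_ xy] /andP[_ xy'] e.
have [a b] := interval_sub xy e; have [a' b'] := interval_sub xy' (esym e).
by congr pair; [exact: (anc_antisym a' a) | exact: (anc_antisym b b')].
Qed.

Lemma spider_interval S : is_spider R -> connected_set S -> u \notin S ->
  exists2 q, q \in anc_pairs & S = interval_of q.
Proof.
move=> sp conn uS; have [t tS top] := connected_top uS conn.
have tu : t != u by apply: contraNneq uS => <-.
pose y := [arg max_(x > t | x \in S) dep x].
have [yS ymax] : y \in S /\ forall x, x \in S -> dep x <= dep y.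
  by rewrite /y; case: arg_maxnP.
have [ty tyS] := top y yS.
exists (t, y); first by rewrite inE /= tu.
apply/setP => x; rewrite inE /=; apply/idP/andP => [xS|[]]; last exact: tyS.
have [tx _] := top x xS; split=> //.
apply: spider_comparable => //; last exact: ymax.
- exact: anc_nonroot tx tu.
- exact: anc_nonroot ty tu.
by rewrite -(branch_root_anc tu tx) -(branch_root_anc tu ty).
Qed.

Definition fork x y : {set G} := [set z | anc z x || anc z y].

(** Two subtrees arise from one unordered pair of incomparable vertices, so
    that ordered pairs parametrise them injectively: the order, measured by an
    arbitrary enumeration, decides whether the origin is kept. *)
Definition fork_of (q : G * G) : {set G} :=
  if enum_rank q.1 < enum_rank q.2 then fork q.1 q.2 else fork q.1 q.2 :\ u.

Lemma fork_connected x y : connected_set (fork x y).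
Proof.
have uV : u \in fork x y by rewrite inE anc_root.
rewrite (connected_origin uV); apply/forall_inP => z; rewrite !inE.
by case/orP=> /(anc_trans (anc_parent R z)) ->; rewrite ?orbT.
Qed.

Lemma forkedP q : reflect
  [/\ q.1 != u, q.2 != u, br q.1 = br q.2, ~~ anc q.1 q.2 & ~~ anc q.2 q.1]
  (q \in forked R).
Proof.
rewrite inE; apply: (iffP and5P) => [] [? ? b ? ?]; split=> //; exact/eqP.
Qed.

Lemma fork_of_connected q : q \in forked R -> connected_set (fork_of q).
Proof.
case: q => x y /forkedP[/= xu yu bxy _ _]; rewrite /fork_of /=.
case: ifP => _; first exact: fork_connected.
apply: (@connected_of_top _ R _ (br x)).
- rewrite !inE anc_branch_root orTb andbT.
  exact: child_nonroot (branch_root_child xu).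
- exact: child_nonroot (branch_root_child xu).
- move=> z; rewrite !inE => /andP[zu /orP[] zx].
    by rewrite -(branch_root_anc zu zx) anc_branch_root.
  by rewrite bxy -(branch_root_anc zu zx) anc_branch_root.
move=> z w; rewrite !inE => /andP[zu zxy] bw wz; apply/andP; split.
  exact: anc_nonroot bw (child_nonroot (branch_root_child xu)).
by case/orP: zxy => /(anc_trans wz) ->; rewrite ?orbT.
Qed.

Lemma mem_fork_of q : q \in forked R -> q.1 \in fork_of q /\ q.2 \in fork_of q.
Proof.
case: q => x y /forkedP[/= xu yu _ _ _]; rewrite /fork_of /=.
by case: ifP; rewrite !inE !anc_refl ?xu ?yu ?orbT.
Qed.

(** A span contains only comparable vertices of a branch. *)
Lemma fork_of_span q c : q \in forked R -> c \in legs -> fork_of q != span c.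
Proof.
move=> qf cF; apply/eqP => e; have [m1 m2] := mem_fork_of qf.
case/forkedP: qf => q1 q2 b n1 n2; rewrite e in m1 m2.
by have := span_comparable cF q1 q2 b m1 m2; rewrite (negbTE n1) (negbTE n2).
Qed.

Lemma fork_of_interval q x y : q \in forked R -> fork_of q != interval x y.
Proof.
move=> qf; apply/eqP => e; have [m1 m2] := mem_fork_of qf.
case/forkedP: qf => q1 q2 b n1 n2; rewrite e !inE in m1 m2.
case/andP: m1 => _ m1; case/andP: m2 => _ m2.
by have := anc_total m1 m2; rewrite (negbTE n1) (negbTE n2).
Qed.

(** The two vertices are the maximal elements of the fork, and the presence of
    the origin tells their order. *)
Lemma fork_of_inj : {in forked R &, injective fork_of}.
Proof.
move=> [x y] [x' y'] /forkedP[/= xu yu _ nxy nyx] /forkedP[/= xu' yu' _ nxy' nyx'] e.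
have mem a b z : z != u -> (z \in fork_of (a, b)) = anc z a || anc z b.
  by move=> zu; rewrite /fork_of /=; case: ifP; rewrite !inE ?zu.
have E z : z != u -> anc z x || anc z y = anc z x' || anc z y'.
  by move=> zu; rewrite -!mem // e.
have fl : (enum_rank x < enum_rank y) = (enum_rank x' < enum_rank y').
  have : (u \in fork_of (x, y)) = (u \in fork_of (x', y')) by rewrite e.
  by rewrite /fork_of /=; do 2!case: ifP; rewrite !inE ?eqxx ?anc_root.
have hx := E x xu; have hy := E y yu; have hx' := E x' xu'; have hy' := E y' yu'.
rewrite anc_refl (negbTE nxy) /= in hx; rewrite anc_refl orbT in hy.
rewrite anc_refl (negbTE nxy') orTb in hx'; rewrite anc_refl orbT in hy'.
have sep a b z : ~~ anc a b -> anc a z -> anc z b -> False.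
  by move=> /negP n az zb; apply: n; apply: anc_trans zb.
have [xx'|xy'] := orP (esym hx).
  have x'x : anc x' x by case/orP: hx' => // /(sep _ _ _ nxy xx').
  have exx := anc_antisym xx' x'x; rewrite exx in nyx *.
  have yy' : anc y y' by case/orP: (esym hy) => // h; rewrite h in nyx.
  by rewrite (anc_antisym yy') //; case/orP: hy' => // h; rewrite exx in h; rewrite h in nyx'.
have y'x : anc y' x by case/orP: hy' => // /(sep _ _ _ nxy xy').
have exy := anc_antisym xy' y'x; rewrite exy in nyx.
have yx' : anc y x' by case/orP: (esym hy) => // h; rewrite h in nyx.
have x'y : anc x' y by case/orP: hx' => // h; rewrite exy in h; rewrite h in nxy'.
have eyx := anc_antisym yx' x'y; rewrite exy eyx in fl nxy.
have [lt|gt|/ord_inj/enum_rank_inj eq] := ltngtP (enum_rank y') (enum_rank x').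
- by rewrite lt ltnNge (ltnW lt) in fl.
- by rewrite gt ltnNge (ltnW gt) in fl.
by rewrite eq anc_refl in nxy.
Qed.

End Families.

(** * Comparing the number of subtrees with that of a spider *)

Section Counting.
Variables (G : sgraph) (R : rooting G).
Implicit Types (x y z v i : G) (S : {set G}) (c : {ffun G -> G}).

Local Notation u := (origin R).
Local Notation p := (parent R).
Local Notation dep := (depth R).
Local Notation anc := (anc R).
Local Notation C := (children R).
Local Notation br := (branch_root R).
Local Notation m := (fun i => #|branch R i|).
Local Notation lam := (tip_below R).

Lemma card_sum_mem (T : finType) (A : {set T}) : #|A| = \sum_(x : T) (x \in A).
Proof. by rewrite -sum1_card big_mkcond; apply: eq_bigr => x _; case: (x \in A). Qed.

Lemma sum_branches : \sum_(i in C) m i = #|[set~ u]|.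
Proof.
rewrite -sum1_card [RHS](partition_big br (mem C)) /=; last first.
  by move=> x xu; apply: branch_root_child; rewrite !inE in xu.
apply: eq_bigr => i iC; rewrite -sum1_card; apply: eq_bigl => x; rewrite !inE.
apply/idP/andP => [ix|[xu /eqP <-]]; last exact: anc_branch_root.
by rewrite (branch_nonroot iC ix) (branch_rootE iC ix).
Qed.

Lemma sum_branches_sqr :
  \sum_(i in C) m i * m i = #|[set q : G * G | [&& q.1 != u, q.2 != u & br q.1 == br q.2]]|.
Proof.
rewrite -sum1_card [RHS](partition_big (fun q => br q.1) (mem C)) /=; last first.
  by move=> q; rewrite in_set => /andP[qu _]; apply: branch_root_child.
apply: eq_bigr => i iC; rewrite -cardsX -sum1_card; apply: eq_bigl => -[x y].
rewrite !inE /=; apply/andP/andP => [[ix iy]|[/and3P[xu yu /eqP e] /eqP <-]].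
  rewrite (branch_nonroot iC ix) (branch_nonroot iC iy).
  by rewrite (branch_rootE iC ix) (branch_rootE iC iy) !eqxx.
by split; [|rewrite e]; apply: anc_branch_root.
Qed.

(** Count the ordered pairs of vertices of the same branch: they are
    comparable in one direction or the other, in both when they are equal, or
    incomparable. *)
Lemma double_sum_bin :
  (\sum_(i in C) 'C((m i).+1, 2)) * 2 = #|anc_pairs R| * 2 + #|forked R|.
Proof.
rewrite big_distrl /= (eq_bigr (fun i => m i * m i + m i)); last first.
  by move=> i _; rewrite double_bin2S mulSn addnC.
rewrite big_split /= sum_branches_sqr sum_branches.
have -> : #|[set~ u]| = #|[set q : G * G | (q.1 != u) && (q.1 == q.2)]|.
  rewrite -(card_imset _ (f := fun x : G => (x, x))); last by move=> x y [].
  apply: eq_card => -[x y]; rewrite !inE /=; apply/imsetP/andP => [[z]|[xu /eqP <-]].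
    by rewrite !inE => zu [-> ->].
  by exists x; rewrite ?inE.
have flip : #|anc_pairs R| = #|[set q : G * G | (q.2 != u) && anc q.2 q.1]|.
  have swapI : injective (fun q : G * G => (q.2, q.1)) by move=> [? ?] [? ?] [-> ->].
  rewrite -(card_imset _ swapI); apply: eq_card => -[x y]; rewrite !inE /=.
  apply/idP/imsetP => [h|[[a b]]]; last by rewrite !inE => h [-> ->].
  by exists (y, x); rewrite ?inE.
rewrite muln2 -addnn {2}flip !card_sum_mem -!big_split /=.
apply: eq_bigr => -[x y] _; rewrite !inE /=.
have [->|xu] /= := eqVneq x u.
  case: (boolP (y == u)) => //= yu; case: (boolP (anc y u)) => //.
  by move/anc_nonroot/(_ yu); rewrite eqxx.
have [->|yu] /= := eqVneq y u.
  case: (boolP (anc x u)) => [/anc_nonroot/(_ xu)|_]; first by rewrite eqxx.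
  by rewrite (negbTE xu).
have [<-|xy] := eqVneq x y; first by rewrite !eqxx !anc_refl.
case: (boolP (anc x y)) => [axy|nxy]; case: (boolP (anc y x)) => [ayx|nyx].
- by rewrite (anc_antisym axy ayx) eqxx in xy.
- by rewrite (branch_root_anc xu axy) eqxx.
- by rewrite (branch_root_anc yu ayx) eqxx.
by rewrite andbT addn0.
Qed.

Lemma spider_weight_branches : spider_weight (branch_sizes R) * 2
  = (#|legs R| + #|anc_pairs R|) * 2 + #|forked R|.
Proof.
rewrite /spider_weight !big_map !big_enum /= card_legs !mulnDl double_sum_bin.
by rewrite addnA.
Qed.

Definition spans : {set {set G}} := [set span R c | c in legs R].
Definition intervals : {set {set G}} := [set interval_of R q | q in anc_pairs R].
Definition forks : {set {set G}} := [set fork_of R q | q in forked R].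

Lemma disjoint_spans_intervals : [disjoint spans & intervals].
Proof.
rewrite -setI_eq0; apply/eqP/setP => S; rewrite !inE; apply/negP => /andP[].
move=> /imsetP[c _ ->] /imsetP[[x y]]; rewrite inE /= => /andP[xu _] e.
have := interval_origin y xu.
by rewrite -[interval _ _ _]/(interval_of R (x, y)) -e span_origin.
Qed.

Lemma disjoint_forks : [disjoint spans :|: intervals & forks].
Proof.
rewrite -setI_eq0; apply/eqP/setP => S; rewrite !inE; apply/negP => /andP[h /imsetP[q qf Sq]].
case/orP: h => /imsetP[a aP]; rewrite Sq => e.
  by have := fork_of_span qf aP; rewrite e eqxx.
by have := fork_of_interval a.1 a.2 qf; rewrite e eqxx.
Qed.

Lemma cardsU_disjoint (T : finType) (A B : {set T}) :
  [disjoint A & B] -> #|A :|: B| = #|A| + #|B|.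
Proof. by rewrite -leq_card_setU => /eqP. Qed.

Lemma subtree_families : spans :|: intervals :|: forks \subset [set S | connected_set S].
Proof.
apply/subsetP => S; rewrite !inE => /orP[/orP[]|] /imsetP[a aP ->].
- exact: span_connected.
- by move: aP; rewrite inE => /andP[au ab]; apply: interval_connected.
exact: fork_of_connected.
Qed.

Lemma card_subtree_families :
  #|spans :|: intervals :|: forks| = #|legs R| + #|anc_pairs R| + #|forked R|.
Proof.
rewrite !cardsU_disjoint ?disjoint_forks ?disjoint_spans_intervals //.
rewrite !card_in_imset //; [exact: fork_of_inj | exact: interval_inj | exact: span_inj].
Qed.

(** The incomparable pairs contribute twice as many subtrees as the weight
    counts for them. *)
Theorem num_subtrees_not_spider :
  ~~ is_spider R -> spider_weight (branch_sizes R) < num_subtrees G.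
Proof.
rewrite spider_forked -card_gt0 => f0.
have arith (a b k d e : nat) :
    0 < d -> a * 2 = (b + k) * 2 + d -> b + k + d <= e -> a < e by lia.
apply: (arith _ _ _ _ _ f0 spider_weight_branches).
by rewrite -card_subtree_families; apply: subset_leq_card subtree_families.
Qed.

Theorem num_subtrees_spider :
  is_spider R -> num_subtrees G = spider_weight (branch_sizes R).
Proof.
move=> sp; have /eqP f0 : forked R == set0 by rewrite -spider_forked.
have := card_subtree_families.
have -> : spans :|: intervals :|: forks = [set S | connected_set S].
  apply/eqP; rewrite eqEsubset subtree_families /=; apply/subsetP => S; rewrite inE => conn.
  rewrite in_setU /forks f0 imset0 in_set0 orbF in_setU; have [uS|uS] := boolP (u \in S).
    by have [c cF ->] := spider_span sp conn uS; rewrite imset_f.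
  by have [q qP ->] := spider_interval sp conn uS; rewrite imset_f ?orbT.
rewrite f0 cards0 addn0 => sum; apply/eqP; rewrite -(eqn_pmul2r (isT : 0 < 2)).
by rewrite spider_weight_branches f0 cards0 addn0 -sum.
Qed.

Definition has_tip S : bool := [exists x in S, tip R x].

(** Only the tip fixed for the branch is looked for, although a branch may
    have several: this keeps the count below exact for every tree. *)
Definition tip_legs : {pred {ffun G -> G}} :=
  [pred c in legs R | [exists i in C, c i == lam i]].

Lemma has_tipI S x : x \in S -> tip R x -> has_tip S.
Proof. by move=> xS xt; apply/existsP; exists x; rewrite xS. Qed.

Definition blunt_leg i : pred G :=
  if i \in C then [pred x | (x == u) || (anc i x && (x != lam i))] else pred1 u.

Definition blunt_legs : {pred {ffun G -> G}} := family blunt_leg.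

Lemma card_tip_legs :
  #|tip_legs| = \prod_(i in C) (m i).+1 - \prod_(i in C) m i.
Proof.
have lamu i : i \in C -> lam i != u.
  by move=> iC; apply: branch_nonroot iC (anc_tip_below R i).
have <- : #|blunt_legs| = \prod_(i in C) m i.
  rewrite card_family foldrE big_map big_enum /= [RHS]big_mkcond /=.
  apply: eq_bigr => i _; rewrite /blunt_leg; case: ifP => iC; last by rewrite card1.
  (* The origin, among the choices, takes the place of the tip in the branch. *)
  rewrite (cardD1 u) [RHS](cardD1 (lam i)) !inE eqxx anc_tip_below !add1n; congr _.+1.
  apply: eq_card => x; rewrite !inE.
  have [->|xu] := eqVneq x u; last by rewrite /= andbC.
  case: (boolP (anc i u)) => [/(branch_nonroot iC)|_]; first by rewrite eqxx.
  by rewrite andbF.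
rewrite -card_legs.
have bluntP c : (c \in blunt_legs) =
    (c \in legs R) && ~~ [exists i in C, c i == lam i].
  apply/familyP/andP => [h|[/legsP h /existsPn n] i].
    split.
      apply/legsP => i; have := h i; rewrite /blunt_leg.
      case: ifP => iC; rewrite !inE; last by move/eqP; left.
      by case/orP=> [/eqP|/andP[]]; [left | right].
    apply/negP => /existsP[i /andP[iC /eqP e]]; have := h i.
    by rewrite /blunt_leg iC !inE e eqxx andbF orbF (negbTE (lamu i iC)).
  have := n i; rewrite /blunt_leg; case: (h i) => [->|[iC ic]].
    by case: ifP; rewrite !inE eqxx.
  by rewrite iC !inE ic => /= ->; rewrite orbT.
rewrite -(cardID blunt_legs (legs R)).
rewrite [X in _ = X + _ - _](_ : _ = #|blunt_legs|); last first.
  apply: eq_card => c; rewrite -[LHS]/((c \in legs R) && (c \in blunt_legs)).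
  by rewrite bluntP andbA andbb.
rewrite addKn; apply: eq_card => c.
rewrite -[RHS]/((c \notin blunt_legs) && (c \in legs R)) bluntP.
rewrite -[LHS]/((c \in legs R) && [exists i in C, c i == lam i]).
by rewrite negb_and negbK andb_orl andNb andbC.
Qed.

Definition tip_spans : {set {set G}} := [set span R c | c in tip_legs].
Definition tip_intervals : {set {set G}} := [set interval R x (lam x) | x in [set~ u]].

Lemma card_tip_spans : #|tip_spans| = #|tip_legs|.
Proof.
apply: card_in_imset => c d /andP[cF _] /andP[dF _]; exact: span_inj.
Qed.

Lemma card_tip_intervals : #|tip_intervals| = \sum_(i in C) m i.
Proof.
rewrite sum_branches; apply: card_in_imset => x y _ _ e.
have [a _] := interval_sub (anc_tip_below R x) e.
have [b _] := interval_sub (anc_tip_below R y) (esym e).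
exact: anc_antisym b a.
Qed.

Lemma sub_tip_intervals : tip_intervals \subset intervals.
Proof.
apply/subsetP => S /imsetP[x xu ->]; apply/imsetP; exists (x, lam x) => //.
by move: xu; rewrite !inE anc_tip_below => ->.
Qed.

Lemma sub_tip_spans : tip_spans \subset spans.
Proof. by apply/subsetP => S /imsetP[c /andP[cF _] ->]; apply: imset_f. Qed.

(** Tip spans contain the origin and tip intervals avoid it, so the sizes of
    these two families of leaf-containing subtrees add up. *)
Lemma spider_leaf_weight_branches :
  spider_leaf_weight (branch_sizes R) = #|tip_spans :|: tip_intervals|.
Proof.
rewrite cardsU_disjoint.
  rewrite card_tip_spans card_tip_intervals card_tip_legs.
  by rewrite /spider_leaf_weight !big_map !big_enum.
apply: disjointWl sub_tip_spans _; apply: disjointWr sub_tip_intervals _.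
exact: disjoint_spans_intervals.
Qed.

Lemma tip_families :
  tip_spans :|: tip_intervals \subset [set S | connected_set S && has_tip S].
Proof.
apply/subsetP => S; rewrite !inE => /orP[] /imsetP[a aP ->].
  rewrite span_connected; case/andP: aP => _ /existsP[i /andP[iC /eqP e]].
  apply: (has_tipI (x := lam i)); last exact: tip_tip_below.
  by apply: (@mem_span _ R _ i); rewrite e anc_refl.
rewrite !inE in aP; rewrite interval_connected ?anc_tip_below //.
apply: (has_tipI (x := lam a)); last exact: tip_tip_below.
by rewrite inE anc_tip_below anc_refl.
Qed.

Lemma num_leaf_subtrees_tip : 1 < #|C| ->
  num_leaf_subtrees G = #|[set S | connected_set S && has_tip S]|.
Proof.
move=> C1; apply: eq_card => S; rewrite !inE; congr (_ && _).
by apply: eq_existsb => x; rewrite (leaf_tip x C1).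
Qed.

(** Descending from a vertex keeps it incomparable to the other one, so an
    incomparable pair can be moved to have a tip as its first vertex. *)
Lemma tip_fork q : q \in forked R ->
  exists2 q', q' \in forked R & tip R q'.1.
Proof.
case/forkedP; case: q => x y /= xu yu b nxy nyx.
have xl := anc_tip_below R x; have lu := anc_nonroot xl xu.
exists (lam x, y); last exact: tip_tip_below.
apply/forkedP; split=> //=.
- by rewrite -(branch_root_anc xu xl).
- by apply: contra nxy => /(anc_trans xl).
by apply/negP => /(anc_total xl); rewrite (negbTE nxy) (negbTE nyx).
Qed.

Theorem num_leaf_subtrees_not_spider : 1 < #|C| ->
  ~~ is_spider R -> spider_leaf_weight (branch_sizes R) < num_leaf_subtrees G.
Proof.
move=> C1; rewrite spider_forked => /set0Pn[q0 /tip_fork[q qf qt]].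
rewrite num_leaf_subtrees_tip // spider_leaf_weight_branches.
apply: proper_card; apply/properP; split; first exact: tip_families.
exists (fork_of R q).
  rewrite inE fork_of_connected //=; apply: (has_tipI _ qt).
  by case: (mem_fork_of qf).
apply/negP => h; have /pred0P/(_ (fork_of R q)) := disjoint_forks.
rewrite /= !inE (imset_f _ qf) andbT; case/setUP: h => h.
  by rewrite (subsetP sub_tip_spans _ h).
by rewrite (subsetP sub_tip_intervals _ h) orbT.
Qed.

Lemma spider_tip x : is_spider R -> x != u -> tip R x ->
  forall y, y != u -> br x = br y -> anc y x.
Proof.
move=> sp xu /tipP xt y yu b; have [le|/ltnW le] := leqP (dep x) (dep y).
  by rewrite (xt y) ?anc_refl //; apply: spider_comparable.
by apply: spider_comparable.
Qed.

Lemma spider_tip_below x y : is_spider R -> tip R x -> x != u -> anc y x -> y != u ->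
  lam y = x.
Proof.
move=> sp xt xu yx yu; have yl := anc_tip_below R y; have lu := anc_nonroot yl yu.
apply/esym/(tipP _ _ (tip_tip_below R y)).
apply: (spider_tip sp xu xt lu).
by rewrite -(branch_root_anc yu yx) -(branch_root_anc yu yl).
Qed.

Theorem num_leaf_subtrees_spider : 1 < #|C| ->
  is_spider R -> num_leaf_subtrees G = spider_leaf_weight (branch_sizes R).
Proof.
move=> C1 sp; rewrite num_leaf_subtrees_tip // spider_leaf_weight_branches.
congr #|pred_of_set _|; apply/eqP; rewrite eqEsubset tip_families andbT.
apply/subsetP => S; rewrite inE => /andP[conn /existsP[x /andP[xS xt]]].
have xu := tip_nonroot C1 xt.
rewrite in_setU; have [uS|uS] := boolP (u \in S).
  have [c cF eS] := spider_span sp conn uS; rewrite eS imset_f //.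
  rewrite inE; apply/andP; split=> //; apply/existsP.
  move: xS; rewrite eS inE => /existsP[i] /(tipP _ _ xt) ci; exists i.
  have ciu : c i != u by rewrite ci.
  have [e|[iC ix]] := legsP _ _ cF i; first by rewrite e eqxx in ciu.
  rewrite iC ci; apply/eqP/esym/spider_tip_below => //; last exact: child_nonroot.
  by rewrite -ci.
have [[a b]] := spider_interval sp conn uS; rewrite inE /= => /andP[au ab] eS.
move: xS; rewrite eS inE => /andP[/= ax /(tipP _ _ xt) bx].
apply/orP; right; apply/imsetP; exists a; first by rewrite !inE.
by rewrite (spider_tip_below sp xt xu ax au) /interval_of /= bx.
Qed.
End Counting.

(** * Rooting a tree at a given vertex *)

Section TreeRooting.
Variable G : sgraph.
Implicit Types (x y z : G) (s t : seq G).

(** Up to the first vertex z of the first path that lies on the second one,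
    the two paths would form a cycle through x and z. *)
Lemma diverging_paths_meet_not x a b s t : acyclic G ->
  path (@adj G) x (a :: s) -> path (@adj G) x (b :: t) ->
  uniq (x :: a :: s) -> uniq (x :: b :: t) ->
  last a s = last b t -> a = b.
Proof.
move=> acy px qx ux vx e.
have : has (mem (b :: t)) (a :: s).
  by apply/hasP; exists (last a s); rewrite ?mem_last //= e mem_last.
move def_p: (a :: s) px ux => p px ux; move def_q: (b :: t) qx vx => q qx vx hpq.
case: (split_find hpq) px ux def_p => z p1 p2 /= zq np px ux def_p.
case: (path.splitP zq) qx vx def_q np => q1 q2 qx vx def_q np.
have pathp : path (@adj G) x (rcons p1 z) by move: px; rewrite cat_path => /andP[].
have pathq : path (@adj G) x (rcons q1 z) by move: qx; rewrite cat_path => /andP[].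
have sym : path (@adj G) z (rcons (rev q1) x).
  have := pathq; rewrite (eq_path (e' := fun y => @adj G ^~ y)); last exact: adj_sym.
  by rewrite -rev_path last_rcons belast_rcons rev_cons.
have : size (x :: rcons p1 z ++ rev q1) < 3.
  apply: acy; rewrite /ucycle /= rcons_cat cat_path pathp last_rcons sym /=.
  move: ux vx; rewrite /= !cat_uniq !mem_cat !rcons_uniq !negb_or.
  case/and3P=> /andP[xp _] /andP[zp1 up] _ /andP[/andP[xq _] /and3P[/andP[zq1 uq] _ _]].
  rewrite mem_rev rev_uniq uq xp (contra _ xq) ?mem_rcons ?inE; last first.
    by move=> ->; rewrite orbT.
  rewrite zp1 up !andbT /=; apply/hasPn => w; rewrite mem_rev mem_rcons inE negb_or => wq1.
  rewrite (contraNneq _ zq1) => [|<- //] /=; apply: contra np => wp1.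
  by apply/hasP; exists w; rewrite //= mem_cat mem_rcons inE wq1 orbT.
(* Being too short, the cycle leaves nothing before z on either path. *)
rewrite /= size_cat size_rcons size_rev.
case: p1 {np px ux pathp} def_p => [|? ?] /= def_p; last by lia.
case: q1 {qx vx pathq sym} def_q => [|? ?] /= def_q; last by lia.
by case: def_p def_q => -> _ [-> _].
Qed.

Lemma simple_path_unique x s t : acyclic G ->
  path (@adj G) x s -> path (@adj G) x t -> uniq (x :: s) -> uniq (x :: t) ->
  last x s = last x t -> s = t.
Proof.
move=> acy; elim: s x t => [|a s IH] x [|b t] // px qx ux vx /= e.
- by move: vx; rewrite cons_uniq e mem_last.
- by move: ux; rewrite cons_uniq -e mem_last.
have ab := diverging_paths_meet_not acy px qx ux vx e; subst b.
case/andP: px => _ px; case/andP: qx => _ qx; case/andP: ux => _ ux; case/andP: vx => _ vx.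
by rewrite (IH a t).
Qed.

Hypothesis treeG : is_tree G.
Variable u : G.

(** As simple paths are unique, the one from x to u serves to define the
    parent of x, its first step, and the depth of x, its length. *)
Definition simple_path_to x s : bool :=
  [&& path (@adj G) x s, uniq (x :: s) & last x s == u].

Lemma simple_path_exists x : exists s, simple_path_to x s.
Proof.
have [/andP[_ /forall_inP conn] _] := treeG.
have /forall_inP/(_ u (in_setT u))/connectP[s ps us] := conn x (in_setT x).
move: us; case: (shortenP ps) => t pt ut _ us.
exists t; rewrite /simple_path_to ut us eqxx !andbT.
by apply: sub_path pt => y z /and3P[].
Qed.

Definition path_to_root x : seq G := xchoose (simple_path_exists x).

Lemma path_to_root_unique x s : simple_path_to x s -> path_to_root x = s.
Proof.
case/and3P=> ps us /eqP ls; have /and3P[pt ut /eqP lt] := xchooseP (simple_path_exists x).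
by apply: simple_path_unique pt ps ut us _; [case: treeG | rewrite lt].
Qed.

Lemma path_to_rootP x : simple_path_to x (path_to_root x).
Proof. exact: xchooseP. Qed.

Definition tree_parent x : G := head x (path_to_root x).
Definition tree_depth x : nat := size (path_to_root x).

Lemma path_to_root_root : path_to_root u = [::].
Proof. by apply: path_to_root_unique; rewrite /simple_path_to /= eqxx. Qed.

Lemma path_to_root_cons x : x != u ->
  path_to_root x = tree_parent x :: path_to_root (tree_parent x) /\ adj x (tree_parent x).
Proof.
move=> xu; have := path_to_rootP x; rewrite /tree_parent.
case: (path_to_root x) => [|a s] /and3P[] /=; first by move=> _ _ /eqP e; rewrite e eqxx in xu.
move=> /andP[xa pa] /and3P[_ na ua] l; split=> //; congr (_ :: _).
by apply/esym/path_to_root_unique; rewrite /simple_path_to pa l /= na ua.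
Qed.

Lemma tree_parent_root : tree_parent u = u.
Proof. by rewrite /tree_parent path_to_root_root. Qed.

Lemma tree_depth_root : tree_depth u = 0.
Proof. by rewrite /tree_depth path_to_root_root. Qed.

Lemma tree_depth_parent x : x != u -> tree_depth x = (tree_depth (tree_parent x)).+1.
Proof. by rewrite /tree_depth => /path_to_root_cons[-> _]. Qed.

(** Given an edge x y, if y is on the path from x to u then this path starts
    with y; otherwise x prolongs it to the path from y. *)
Lemma tree_adj_parent x y :
  adj x y = (x != u) && (tree_parent x == y) || (y != u) && (tree_parent y == x).
Proof.
apply/idP/orP => [xy|[/andP[xu /eqP <-]|/andP[yu /eqP <-]]]; first last.
- by rewrite adj_sym; case: (path_to_root_cons yu).
- by case: (path_to_root_cons xu).
have := path_to_rootP x; case: (boolP (y \in path_to_root x)) => yx.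
  case/splitPr: yx => s t /and3P[ps us ls]; left.
  have e : path_to_root x = y :: t.
    apply: path_to_root_unique; rewrite /simple_path_to /= xy.
    move: ps ls; rewrite cat_path last_cat /= => /andP[_ /andP[_ ->]] ->; rewrite andbT.
    by move: us; rewrite /= cat_uniq mem_cat negb_or => /andP[/andP[_ ->] /and3P[_ _]].
  rewrite /tree_parent e /= eqxx andbT; apply: contra_eq_neq e => ->.
  by rewrite path_to_root_root.
case/and3P=> ps us ls; right.
have ne : y != x by apply: contraTneq xy => ->; rewrite adj_irr.
have e : path_to_root y = x :: path_to_root x.
  apply: path_to_root_unique; rewrite /simple_path_to /= adj_sym xy ps ls.
  by rewrite inE negb_or yx ne; case/andP: us => xp up; rewrite xp !andbT.
rewrite /tree_parent e /= eqxx andbT; apply: contra_eq_neq e => ->.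
by rewrite path_to_root_root.
Qed.

Definition tree_rooting : rooting G :=
  Rooting tree_parent_root tree_depth_root tree_depth_parent tree_adj_parent.
End TreeRooting.

(** * Branches of a tree with a perfect matching *)

Section Matching.
Variables (G : sgraph) (R : rooting G) (M : {set {set G}}).
Hypothesis pm : perfect_matching M.
Local Notation u := (origin R).
Local Notation p := (parent R).
Local Notation C := (children R).

Lemma single_branch_neighbour i y :
  i \in C -> #|branch R i| = 1 -> adj i y -> y = u.
Proof.
move=> iC /eqP/cards1P[a ba] ; rewrite (adj_parent R).
have pi : p i = u by move: iC; rewrite inE => /andP[_ /eqP].
have one z : anc R i z -> z = i.
  move=> iz; have : z \in branch R i by rewrite inE.
  have : i \in branch R i by rewrite inE anc_refl.
  by rewrite ba !inE => /eqP -> /eqP.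
case/orP=> /andP[yu /eqP e]; first by rewrite -e.
have iy : anc R i y by rewrite -e; apply: anc_parent.
by rewrite (one y iy) pi in e; move: (child_nonroot iC); rewrite e eqxx.
Qed.

(** A branch that is a single vertex can only be matched with the origin. *)
Lemma matched_block i : i \in C -> #|branch R i| = 1 ->
  pblock M u = [set i; u].
Proof.
move=> iC bi; case/andP: pm => Medge /and3P[/eqP Mcov Mtriv _].
have icov : i \in cover M by rewrite Mcov inE.
have BM := pblock_mem icov; have iB : i \in pblock M i by rewrite mem_pblock.
suff BE : pblock M i = [set i; u].
  by rewrite -BE; apply: def_pblock => //; rewrite BE !inE eqxx orbT.
have /imsetP[[a b]] := subsetP Medge _ BM.
rewrite inE /= => ab BE; move: iB; rewrite BE !inE => /orP[]/eqP e; subst i.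
  by rewrite (single_branch_neighbour iC bi ab).
by rewrite setUC (single_branch_neighbour iC bi (y := a)) // adj_sym.
Qed.

Lemma count_single_branches : count_mem 1 (branch_sizes R) <= 1.
Proof.
rewrite /branch_sizes count_map -size_filter.
have := filter_uniq (preim (fun i => #|branch R i|) (pred1 1)) (enum_uniq (mem C)).
have : all [pred i | (i \in C) && (#|branch R i| == 1)]
    (filter (preim (fun i => #|branch R i|) (pred1 1)) (enum C)).
  by apply/allP => i; rewrite mem_filter mem_enum /= andbC.
case: (filter _ _) => [|i [|j s]] //= /and3P[/andP[iC /eqP bi] /andP[jC /eqP bj] _].
suff -> : i = j by rewrite inE eqxx.
have : j \in [set i; u] by rewrite -(matched_block iC bi) (matched_block jC bj) !inE eqxx.
by rewrite !inE (negbTE (child_nonroot jC)) orbF => /eqP.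
Qed.
End Matching.

(** * Isomorphisms *)

Section Invariance.
Variables (G H : sgraph) (f : G -> H).
Hypotheses (f_bij : bijective f) (f_adj : {mono f : x y / adj x y}).

Lemma connected_image (S : {set G}) : connected_set S -> connected_set (f @: S).
Proof.
case/andP=> /set0Pn[x0 x0S] /forall_inP conn; apply/andP; split.
  by apply/set0Pn; exists (f x0); apply: imset_f.
apply/forall_inP => _ /imsetP[x xS ->]; apply/forall_inP => _ /imsetP[y yS ->].
have /forall_inP/(_ y yS)/connectP[s] := conn x xS.
elim: s x {xS} => [|z s IH] x /=; first by move=> _ ->; apply: connect0.
case/andP=> /and3P[xS zS xz] sz ey; apply: connect_trans (IH z sz ey).
by apply: connect1; rewrite /= !imset_f //= f_adj.
Qed.

Lemma degree_image x : degree (f x) = degree x.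
Proof.
have f_inj := bij_inj f_bij; case: f_bij => g fK gK.
rewrite /degree -[RHS](card_imset _ f_inj); apply: eq_card => y; rewrite inE.
apply/idP/imsetP => [xy|[z]]; last by rewrite inE => xz ->; rewrite f_adj.
by exists (g y); rewrite ?gK // inE -f_adj gK.
Qed.

Lemma leq_num_subtrees_image : num_subtrees G <= num_subtrees H.
Proof.
rewrite /num_subtrees -(card_imset _ (imset_inj (bij_inj f_bij))).
apply/subset_leq_card/subsetP => S.
by case/imsetP=> A; rewrite !inE => conn ->; apply: connected_image.
Qed.

Lemma leq_num_leaf_subtrees_image : num_leaf_subtrees G <= num_leaf_subtrees H.
Proof.
rewrite /num_leaf_subtrees -(card_imset _ (imset_inj (bij_inj f_bij))).
apply/subset_leq_card/subsetP => S.
case/imsetP=> A; rewrite !inE => /andP[conn /existsP[x /andP[xA xl]]] ->.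
rewrite connected_image //; apply/existsP; exists (f x).
by rewrite imset_f //= /leaf degree_image.
Qed.
End Invariance.

Lemma isomorphic_sym G H : isomorphic G H -> isomorphic H G.
Proof.
case=> f [g fK gK] f_adj; exists g; first by exists f.
by move=> x y; rewrite -f_adj !gK.
Qed.

Lemma isomorphic_num_subtrees G H : isomorphic G H -> num_subtrees G = num_subtrees H.
Proof.
move=> iso; have [g g_bij g_adj] := isomorphic_sym iso; case: iso => f f_bij f_adj.
apply/eqP; rewrite eqn_leq (leq_num_subtrees_image f_bij f_adj).
exact: leq_num_subtrees_image g_bij g_adj.
Qed.

Lemma isomorphic_num_leaf_subtrees G H :
  isomorphic G H -> num_leaf_subtrees G = num_leaf_subtrees H.
Proof.
move=> iso; have [g g_bij g_adj] := isomorphic_sym iso; case: iso => f f_bij f_adj.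
apply/eqP; rewrite eqn_leq (leq_num_leaf_subtrees_image f_bij f_adj).
exact: leq_num_leaf_subtrees_image g_bij g_adj.
Qed.

(** As edges join vertices to their parents, preserving the origin and the
    parents is enough. *)
Lemma rooting_isomorphic G H (RG : rooting G) (RH : rooting H) (h : H -> G) :
  injective h -> #|G| = #|H| -> h (origin RH) = origin RG ->
  (forall x, h (parent RH x) = parent RG (h x)) -> isomorphic G H.
Proof.
move=> h_inj cGH h0 hp; apply: isomorphic_sym; exists h.
  by apply: inj_card_bij => //; rewrite cGH.
by move=> x y; rewrite (adj_parent RG) (adj_parent RH) -!hp -h0 !(inj_eq h_inj).
Qed.

(** * Leg lengths of a spider *)

Section SpiderLegs.
Variables (G : sgraph) (R : rooting G).
Implicit Types (x y l : G).
Local Notation u := (origin R).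
Local Notation p := (parent R).
Local Notation dep := (depth R).
Local Notation br := (branch_root R).
Local Notation lam := (tip_below R).

(** For d at most the depth of l, this is the vertex at depth d on the path
    from the origin to l. *)
Definition leg_vertex l d : G := iter (dep l - d) p l.

Lemma depth_leg_vertex l d : d <= dep l -> dep (leg_vertex l d) = d.
Proof. by move=> le; rewrite depth_iter; lia. Qed.

Lemma parent_leg_vertex l d : d < dep l -> p (leg_vertex l d.+1) = leg_vertex l d.
Proof. by move=> lt; rewrite /leg_vertex -iterS; congr (iter _ p l); lia. Qed.

Lemma leg_vertex0 l : leg_vertex l 0 = u.
Proof. by rewrite /leg_vertex subn0 iter_depth. Qed.

Hypotheses (sp : is_spider R) (C1 : 1 < #|children R|).

Lemma tip_below_branch_root l : tip R l -> lam (br l) = l.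
Proof.
move=> lt; have lu := tip_nonroot C1 lt.
apply: (spider_tip_below sp lt lu (anc_branch_root R l)).
exact: child_nonroot (branch_root_child lu).
Qed.

(** In a spider the branch of a tip l consists of the vertices met on the way
    from l to the origin. *)
Lemma card_branch_tip l : tip R l -> #|branch R (br l)| = dep l.
Proof.
move=> lt; have lu := tip_nonroot C1 lt; have bC := branch_root_child lu.
rewrite -[RHS]card_ord.
rewrite -[RHS](card_imset _ (f := fun j : 'I_(dep l) => iter j p l)); last first.
  move=> i j /(congr1 dep); rewrite !depth_iter => e; apply: val_inj => /=.
  by have := ltn_ord i; have := ltn_ord j; lia.
apply: eq_card => y; rewrite inE; apply/idP/imsetP => [by_|[j _ ->]].
  have yu := branch_nonroot bC by_.
  have yl : anc R y l by apply: (spider_tip sp lu lt yu); rewrite (branch_rootE bC by_).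
  have lt_d : dep l - dep y < dep l.
    by have := anc_depth yl; rewrite -(depth_gt0 R) in yu; lia.
  by exists (Ordinal lt_d); rewrite // -anc_iter.
have ju : iter j p l != u.
  by rewrite -(depth_gt0 R) depth_iter; have := ltn_ord j; lia.
by rewrite -(branch_root_anc ju (fconnect_iter p j l)) anc_branch_root.
Qed.

Lemma branch_sizes_tips : perm_eq (branch_sizes R) [seq dep l | l <- enum (tip R)].
Proof.
have bl i : i \in children R -> br (lam i) = i.
  by move=> iC; apply: branch_rootE (anc_tip_below R i).
rewrite /branch_sizes; have -> : [seq #|branch R i| | i <- enum (children R)] =
    [seq dep l | l <- [seq lam i | i <- enum (children R)]].
  rewrite -map_comp; apply/eq_in_map => i; rewrite mem_enum => iC /=.
  by rewrite -{1}(bl i iC) card_branch_tip // tip_tip_below.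
apply: perm_map; apply: uniq_perm; rewrite ?enum_uniq //.
  rewrite map_inj_in_uniq ?enum_uniq // => i j; rewrite !mem_enum => iC jC e.
  by rewrite -(bl i iC) e bl.
move=> l; rewrite mem_enum; apply/mapP/idP => [[i _ ->]|lt]; first exact: tip_tip_below.
exists (br l); last by rewrite tip_below_branch_root.
by rewrite mem_enum branch_root_child ?(tip_nonroot C1).
Qed.

Lemma tips_of_branch_sizes s : perm_eq (branch_sizes R) s ->
  exists2 L, perm_eq L (enum (tip R)) & s = [seq dep l | l <- L].
Proof.
move=> ps; have := perm_trans (_ : perm_eq s (branch_sizes R)) branch_sizes_tips.
rewrite perm_sym => /(_ ps) /(perm_iotaP 0)[Is pI ->]; rewrite size_map in pI.
exists [seq nth u (enum (tip R)) i | i <- Is].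
  have := perm_map (nth u (enum (tip R))) pI.
  by rewrite map_nth_iota0 // take_size.
rewrite -map_comp; apply/eq_in_map => i; rewrite (perm_mem pI) mem_iota /= => lti.
by rewrite (nth_map u).
Qed.

Lemma leg_vertex_inj l l' d d' : tip R l -> tip R l' -> d <= dep l -> d' <= dep l' ->
  leg_vertex l d = leg_vertex l' d' -> d = d' /\ (0 < d -> l = l').
Proof.
move=> lt lt' le le' e; have ed : d = d'.
  by rewrite -(depth_leg_vertex le) e depth_leg_vertex.
split=> // d0; have vu : leg_vertex l d != u.
  by rewrite -(depth_gt0 R) depth_leg_vertex.
rewrite -(tip_below_branch_root lt) -(tip_below_branch_root lt').
rewrite -(branch_root_anc vu (fconnect_iter p _ l)) e.
by rewrite (branch_root_anc _ (fconnect_iter p _ l')) // -/(leg_vertex l' d') -e.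
Qed.
End SpiderLegs.

(** * The spider T' *)

Section TprimeSpider.
Variables n D : nat.
Hypotheses (D_gt2 : 2 < D) (Dn : 2 * D <= n).
Local Notation V := (Tprime_vertex n D).
Implicit Types x y : V.

Lemma path_length_gt0 : 0 < n - 2 * D + 3. Proof. by lia. Qed.

Definition Tprime_origin : V := inl (Ordinal path_length_gt0).

Definition Tprime_parent x : V :=
  match x with
  | inl i => inl (Ordinal (leq_ltn_trans (leq_pred i) (ltn_ord i)))
  | inr (inl (k, a)) => if a == 0 :> nat then Tprime_origin else inr (inl (k, ord0))
  | inr (inr _) => Tprime_origin
  end.

Definition Tprime_depth x : nat :=
  match x with
  | inl i => i
  | inr (inl (_, a)) => a.+1
  | inr (inr _) => 1
  end.

Lemma Tprime_parent_origin : Tprime_parent Tprime_origin = Tprime_origin.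
Proof. by congr inl; apply: val_inj. Qed.

Lemma Tprime_depth_parent x :
  x != Tprime_origin -> Tprime_depth x = (Tprime_depth (Tprime_parent x)).+1.
Proof.
case: x => [i|[[k a]|[]]] //= i0; last by case: a => [[|[|a]]].
by rewrite prednK // lt0n; apply: contra i0 => /eqP i0; apply/eqP; congr inl; apply: val_inj.
Qed.

Lemma Tprime_arcE x y :
  Tprime_arc x y = (y != Tprime_origin) && (Tprime_parent y == x).
Proof.
have inlE (a b : 'I_(n - 2 * D + 3)) : (inl a == inl b :> V) = (a == b :> nat).
  by apply/eqP/eqP => [[->] //|/val_inj ->].
have inrE (k l : 'I_(D - 2)) (a b : 'I_2) :
    (inr (inl (k, a)) == inr (inl (l, b)) :> V) = (k == l) && (a == b :> nat).
  apply/eqP/andP => [[-> ->]|[/eqP -> /eqP/val_inj ->]] //; by rewrite !eqxx.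
case: x y => [i|[[k a]|[]]] [j|[[l b]|[]]]; rewrite ?andbF //.
- by rewrite /= /Tprime_origin !inlE /=; lia.
- rewrite /=; case: ifP => b0; rewrite /Tprime_origin ?inlE ?andbF ?andbT //=; lia.
- by rewrite /= /Tprime_origin inlE /= eq_sym.
- rewrite /=; case: ifP => b0; first by rewrite (eqP b0) andbF.
  by rewrite inrE eq_sym; congr (_ && _); have := ltn_ord b; rewrite /=; lia.
- by rewrite /=; case: ifP.
Qed.

Lemma Tprime_adj_parent (x y : Tprime n D) :
  adj x y = (x != Tprime_origin) && (Tprime_parent x == y)
            || (y != Tprime_origin) && (Tprime_parent y == x).
Proof. by rewrite -!Tprime_arcE orbC. Qed.

Definition Tprime_rooting : rooting (Tprime n D) :=
  @Rooting (Tprime n D) Tprime_origin Tprime_parent Tprime_depth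
    Tprime_parent_origin (erefl 0) Tprime_depth_parent Tprime_adj_parent.

Lemma Tprime_parent_inj x y :
  Tprime_parent x != Tprime_origin -> Tprime_parent x = Tprime_parent y -> x = y.
Proof.
have bit (a : 'I_2) : a == 0 :> nat = false -> a = ord_max.
  by move=> a0; apply: val_inj; have := ltn_ord a; rewrite /=; lia.
case: x => [i|[[k a]|[]]]; last by rewrite eqxx.
  move=> i0 e; have {i0 e} : exists j, y = inl j /\ i.-1 = j.-1 /\ i.-1 != 0.
    have {}i0 : i.-1 != 0.
      by apply: contra i0 => /eqP i0; apply/eqP; congr inl; apply: val_inj.
    case: y e => [j|[[l b]|[]]] /=; first by case=> e; exists j.
      by case: ifP => // _ [e]; rewrite e in i0.
    by case=> e; rewrite e in i0.
  by case=> j [-> [e i0]]; congr inl; apply: val_inj => /=; lia.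
rewrite /=; case: ifP => [|/bit -> _]; first by rewrite eqxx.
case: y => [j|[[l b]|[]]] //=.
by case: ifP => // /bit -> [->].
Qed.

Lemma Tprime_spider : is_spider Tprime_rooting.
Proof. by apply/is_spiderP => y z; apply: Tprime_parent_inj. Qed.

Lemma last_path_vertex_subproof : n - 2 * D + 2 < n - 2 * D + 3.
Proof. by lia. Qed.

Definition Tprime_tips : seq V :=
  inr (inr tt) :: inl (Ordinal last_path_vertex_subproof)
    :: [seq inr (inl (k, ord_max)) | k <- enum 'I_(D - 2)].

Lemma uniq_Tprime_tips : uniq Tprime_tips.
Proof.
rewrite /= map_inj_uniq ?enum_uniq; last by move=> ? ? [].
rewrite andbT inE /=; apply/andP; split; apply/negP => /mapP[] //.
Qed.

Lemma mem_Tprime_tips x : (x \in Tprime_tips) = tip Tprime_rooting x.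
Proof.
apply/idP/idP => [xL|].
  apply/childless_tip => z z0; rewrite -[parent _ _]/(Tprime_parent z).
  move: xL; rewrite !inE => /or3P[/eqP ->|/eqP ->|/mapP[k _ ->]].
  - by case: z {z0} => [j|[[l b]|[]]] //=; case: ifP.
  - apply/eqP => e; case: z e {z0} => [j|[[l b]|[]]] //=.
    + by case=> /= e; have := ltn_ord j; lia.
    + by case: ifP => // _ [] /=; lia.
    by case=> /=; lia.
  by case: z {z0} => [j|[[l b]|[]]] //=; case: ifP => // _; apply/eqP => -[].
move=> /tipP xt.
case: x xt => [i|[[k a]|[]]] xt; rewrite !inE //=.
  apply/orP; left; apply/eqP; congr inl; apply: val_inj => /=.
  have [lt|ge] := ltnP i.+1 (n - 2 * D + 3); last by have := ltn_ord i; lia.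
  have : anc Tprime_rooting (inl i : V) (inl (Ordinal lt)).
    by apply/ancP; exists 1; congr inl; apply: val_inj.
  by move/xt => /(congr1 Tprime_depth) /=; lia.
suff -> : a = ord_max by rewrite map_f ?mem_enum.
apply: val_inj; case: a xt => [[|[|a]]] //= lta xt.
have : anc Tprime_rooting (inr (inl (k, Ordinal lta)) : V) (inr (inl (k, ord_max))).
  by apply/ancP; exists 1; congr (inr (inl (_, _))); apply: val_inj.
by move/xt => -[].
Qed.

Lemma card_Tprime : #|Tprime n D| = n.
Proof. by rewrite card_sum card_sum card_prod !card_ord card_unit; lia. Qed.

Lemma card_Tprime_children : 1 < #|children Tprime_rooting|.
Proof.
have lt1 : 1 < n - 2 * D + 3 by lia.
by apply/card_gt1P; exists (inl (Ordinal lt1) : V), (inr (inr tt)); rewrite !inE.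
Qed.

Lemma Tprime_branch_sizes :
  perm_eq (branch_sizes Tprime_rooting) (extremal_lengths D n.-1).
Proof.
apply: perm_trans (branch_sizes_tips Tprime_spider card_Tprime_children) _.
have pL : perm_eq (enum (tip Tprime_rooting)) Tprime_tips.
  apply: uniq_perm; rewrite ?enum_uniq ?uniq_Tprime_tips // => x.
  by rewrite mem_enum mem_Tprime_tips.
apply: perm_trans (perm_map _ pL) _.
rewrite /extremal_lengths /Tprime_tips /= -map_comp.
rewrite (_ : n.-1 - 1 - 2 * (D - 2) = n - 2 * D + 2); last lia.
rewrite (_ : map _ _ = nseq (D - 2) 2) //.
rewrite -[D - 2 in RHS](size_enum_ord (D - 2)).
by elim: (enum _) => //= k s ->.
Qed.

Lemma num_subtrees_Tprime :
  num_subtrees (Tprime n D) = spider_weight (extremal_lengths D n.-1).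
Proof.
rewrite (num_subtrees_spider Tprime_spider).
exact: spider_weight_perm Tprime_branch_sizes.
Qed.

Lemma num_leaf_subtrees_Tprime :
  num_leaf_subtrees (Tprime n D) = spider_leaf_weight (extremal_lengths D n.-1).
Proof.
rewrite (num_leaf_subtrees_spider card_Tprime_children Tprime_spider).
exact: spider_leaf_weight_perm Tprime_branch_sizes.
Qed.

(** Match the legs of T' with legs of the same length in G, and send the vertex
    at depth d of a leg to the vertex at depth d of the leg matched with it. *)
Theorem extremal_spider_isomorphic (G : sgraph) (R : rooting G) :
  is_spider R -> 1 < #|children R| -> #|G| = n ->
  perm_eq (branch_sizes R) (extremal_lengths D n.-1) -> isomorphic G (Tprime n D).
Proof.
move=> sp C1 cG /(tips_of_branch_sizes sp C1)[L pL].
case: L pL => [|s [|b L]] //= pL [ds db dL].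
have Ltip l : l \in s :: b :: L -> tip R l by rewrite (perm_mem pL) mem_enum.
have /and3P[sbL bL uL] : uniq (s :: b :: L) by rewrite (perm_uniq pL) enum_uniq.
have {}db : depth R b = n - 2 * D + 2 by rewrite -db; lia.
have sL : size L = D - 2 by rewrite -(size_map (depth R)) -dL size_nseq.
pose e (k : 'I_(D - 2)) := nth s L k.
have eL k : e k \in L by apply: mem_nth; rewrite sL.
have de k : depth R (e k) = 2.
  have : depth R (e k) \in nseq (D - 2) 2 by rewrite dL map_f.
  by rewrite mem_nseq => /andP[_ /eqP].
have e_inj : injective e.
  by move=> k l /eqP; rewrite nth_uniq ?sL // => /eqP/val_inj.
pose tip_of (x : V) := match x with
  | inl _ => b | inr (inl (k, _)) => e k | inr (inr _) => s end.
pose h (x : V) := leg_vertex R (tip_of x) (Tprime_depth x).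
have tip_ofP x : tip R (tip_of x).
  by apply: Ltip; case: x => [i|[[k a]|[]]]; rewrite !inE ?eL ?eqxx ?orbT.
have le_depth x : Tprime_depth x <= depth R (tip_of x).
  case: x => [i|[[k a]|[]]] /=; rewrite ?db ?de -?ds //.
  by have := ltn_ord i; lia.
have hp (x : V) : h (Tprime_parent x) = parent R (h x).
  have [->|x0] := eqVneq x Tprime_origin.
    by rewrite Tprime_parent_origin /h leg_vertex0 parent_origin.
  rewrite /h (Tprime_depth_parent x0) parent_leg_vertex; last first.
    by have := le_depth x; rewrite (Tprime_depth_parent x0).
  by case: x {x0} => [i|[[k a]|[]]] //=; [case: ifP => //= _|]; rewrite !leg_vertex0.
apply: (@rooting_isomorphic G (Tprime n D) R Tprime_rooting h).
- move=> x y /(leg_vertex_inj sp C1 (tip_ofP x) (tip_ofP y) (le_depth x) (le_depth y)).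
  have sb : s != b by apply: contraNneq sbL => ->; rewrite inE eqxx.
  have se k : s != e k by apply: contraNneq sbL => ->; rewrite inE eL orbT.
  have be k : b != e k by apply: contraNneq bL => ->.
  case: x y => [i|[[k a]|[]]] [j|[[l c]|[]]] //= [] ed el.
  + by congr inl; apply: val_inj.
  + by have := be l; rewrite el ?eqxx // ed.
  + by have := sb; rewrite -el ?eqxx // ed.
  + by have := be k; rewrite el ?eqxx.
  + by rewrite (e_inj _ _ (el isT)); congr (inr (inl (_, _))); apply: val_inj; case: ed.
  + by have := se k; rewrite el ?eqxx.
  + by have := sb; rewrite el ?eqxx.
  + by have := se l; rewrite el ?eqxx.
- by rewrite cG card_Tprime.
- exact: leg_vertex0.
exact: hp.
Qed.
End TprimeSpider.

(** * The lower bounds *)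

Lemma sum_branch_sizes (G : sgraph) (R : rooting G) :
  sumn (branch_sizes R) = #|G|.-1.
Proof. by rewrite sumnE big_map big_enum sum_branches cardsC1. Qed.

Lemma branch_sizes_positive (G : sgraph) (R : rooting G) :
  all (leq 1) (branch_sizes R).
Proof.
apply/allP => _ /mapP[i _ ->]; apply/card_gt0P; exists i.
by rewrite inE anc_refl.
Qed.

Lemma large_degree_vertex (G : sgraph) D :
  0 < D -> D <= max_degree G -> exists u : G, D <= degree u.
Proof.
move=> D0 le; apply/existsP; apply: contraLR le => /existsPn h.
rewrite -ltnNge -(prednK D0) ltnS; apply/bigmax_leqP => x _.
by rewrite -ltnS prednK // ltnNge h.
Qed.

Theorem theorem4p6 (n D : nat) (T : sgraph)
    (D_gt2 : 2 < D)
    (card_T : #|T| = n)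
    (tree_T : is_tree T)
    (deg_T : D <= max_degree T)
    (pm_T : exists M : {set {set T}}, perfect_matching M) :
  (* The hypotheses force 2 * D <= n, so no subtraction below is truncated. *)
  let f := 2 * (n - 2 * D + 3) * 3 ^ (D - 2) + 3 * D - 5
           + 'C(n - 2 * D + 3, 2) in
  let fstar := 2 * (n - 2 * D + 3) * 3 ^ (D - 2)
               - (n - 2 * D + 2) * 2 ^ (D - 2) + n - 1 in
  [/\ f <= num_subtrees T,
      fstar <= num_leaf_subtrees T,
      num_subtrees T = f <-> isomorphic T (Tprime n D) &
      num_leaf_subtrees T = fstar <-> isomorphic T (Tprime n D)].
Proof.
have [M pm] := pm_T.
have [u deg_u] := large_degree_vertex (ltn_trans (isT : 0 < 2) D_gt2) deg_T.
pose R := tree_rooting tree_T u.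
have C_D : D <= #|children R| by rewrite -degree_root.
have C1 : 1 < #|children R| by apply: leq_trans C_D; lia.
have s_pos := branch_sizes_positive R; have s_one := count_single_branches R pm.
have s_sum : sumn (branch_sizes R) = n.-1 by rewrite sum_branch_sizes card_T.
have s_size : D <= size (branch_sizes R) by rewrite size_map -cardE.
have Dn : 2 * D <= n.
  by have := sumn_lower_bound s_pos; rewrite s_sum; lia.
have key J N : perm_invariant J -> shift_decreasing J -> merge_decreasing J ->
    (is_spider R -> N = J (branch_sizes R)) ->
    (~~ is_spider R -> J (branch_sizes R) < N) ->
    (isomorphic T (Tprime n D) -> N = J (extremal_lengths D n.-1)) ->
    J (extremal_lengths D n.-1) <= N /\
    (N = J (extremal_lengths D n.-1) <-> isomorphic T (Tprime n D)).
  move=> Jp Js Jm Nsp Nnsp Niso.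
  have := extremal_lengths_min Jp Js Jm D_gt2 s_size s_pos s_one; rewrite s_sum => ext.
  have le : J (extremal_lengths D n.-1) <= J (branch_sizes R).
    by case: ext => [/ltnW|/Jp ->].
  have [sp|nsp] := boolP (is_spider R); last first.
    by have := Nnsp nsp; split; [lia | split=> // ?; lia].
  rewrite (Nsp sp) in Niso *; split=> //; split=> // e.
  case: ext => [|perm]; first by rewrite e ltnn.
  exact: extremal_spider_isomorphic perm.
have [f_le f_eq] := key _ _ spider_weight_perm spider_weight_shift spider_weight_merge
  (num_subtrees_spider (R := R)) (num_subtrees_not_spider (R := R))
  (fun iso => etrans (isomorphic_num_subtrees iso) (num_subtrees_Tprime D_gt2 Dn)).
have [g_le g_eq] := key _ _ spider_leaf_weight_perm spider_leaf_weight_shift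
  spider_leaf_weight_merge
  (num_leaf_subtrees_spider C1) (num_leaf_subtrees_not_spider C1)
  (fun iso => etrans (isomorphic_num_leaf_subtrees iso) (num_leaf_subtrees_Tprime D_gt2 Dn)).
by rewrite -spider_weight_extremal // -spider_leaf_weight_extremal.
Qed.
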